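(* Let $(X,d)$ be a nonempty compact metric space and let $\ell:X\times X\times\mathbb R^2\to\mathbb R$ be continuous and satisfy (l1)–(l4) of the context, with the critical constant of $\ell_0:=\ell(\cdot,\cdot,0,0)$ equal to $0$. Let $\lambda_0>0$ with $\lambda_0\max(\kappa_u,\kappa_v)<1$. Suppose that one of the following holds: (1) $\ell(z,x,u,v)$ is concave in $u$ and concave in $v$; (2) the partial derivatives $\partial_u\ell(z,x,u,v)$ and $\partial_v\ell(z,x,u,v)$ exist and are continuous for $(u,v)$ near $(0,0)$, i.e. on $X\times X\times(-\delta,\delta)^2$ for some $\delta>0$. Then the fixed point $u_\lambda$ of $T_\lambda$ is unique if $\lambda$ is small, i.e. there is $\lambda_1\in(0,\lambda_0)$ such that for every $\lambda\in(0,\lambda_1)$ the operator $T_\lambda$ has exactly one fixed point in $C^0(X,\mathbb R)$.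
   Context: Assumptions on $\ell=\ell(z,x,u,v)$: (l1) $\ell$ is $\kappa_u$-Lipschitz in $u$ and $\kappa_v$-Lipschitz in $v$, for constants $\kappa_u,\kappa_v\ge 0$; (l2) $\ell$ is non-increasing in $u$ and in $v$; (l3) $\partial_u\ell(z,x,0,0)$ and $\partial_v\ell(z,x,0,0)$ exist for all $(z,x)$, and for all $(z,x,u,v)$, $|\ell(z,x,u,v)-\ell(z,x,0,0)-\partial_u\ell(z,x,0,0)u-\partial_v\ell(z,x,0,0)v|\le\frac{|u|+|v|}{2}\,\eta\big(\frac{|u|+|v|}{2}\big)$, where $\eta:[0,\infty)\to[0,\infty)$ is a modulus of continuity (nondecreasing, $\eta(0)=0$, continuous at $0$); (l4) $\int_{X\times X}\big(\partial_u\ell(z,x,0,0)+\partial_v\ell(z,x,0,0)\big)d\mu(z,x)<0$ for all Mather measures $\mu$ of $\ell_0$. Critical constant: the unique $c_0\in\mathbb R$ for which there is a continuous $u:X\to\mathbb R$ with $u(x)=\min_{y\in X}\{u(y)+\ell_0(y,x)\}+c_0$ for all $x$; here it is assumed that $c_0=0$. A Mather measure of $\ell_0$ is a Borel probability measure $\mu$ on $X\times X$ whose two marginals on $X$ coincide and with $\int_{X\times X}\ell_0\,d\mu=-c_0=0$. For $\lambda\in(0,\lambda_0)$ and $\varphi\in C^0(X,\mathbb R)$, $T_\lambda\varphi\in C^0(X,\mathbb R)$ is the unique continuous function with $T_\lambda\varphi(x)=\min_{z\in X}\{\varphi(z)+\ell(z,x,\lambda\varphi(z),\lambda T_\lambda\varphi(x))\}$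 for all $x\in X$. Each $T_\lambda$ has at least one fixed point. In (1), concavity is in each of the variables $u$, $v$ separately. In (2), continuity is joint in $(z,x,u,v)$. *)

(* Defs.v *)
From HB Require Import structures.
From mathcomp Require Import all_boot all_order all_algebra.
From mathcomp Require Import all_classical all_reals all_analysis.

Set Implicit Arguments.
Unset Strict Implicit.
Unset Printing Implicit Defensive.

Import Order.TTheory GRing.Theory Num.Theory.
Import numFieldNormedType.Exports.

Local Open Scope classical_set_scope.
Local Open Scope ring_scope.

(* Nonempty metric spaces: the library's measurable types are pointed, so
   nonemptiness is carried by an (arbitrary) distinguished point. *)
#[short(type="pmetricType")]
HB.structure Definition PointedMetric (K : numDomainType) :=
  {M of Pointed M & Metric K M}.

Notation borel T :=
  [the measurableType _ of g_sigma_algebraType (open : set (set T))].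

Definition is_min (R : realType) (A : set R) (m : R) : Prop :=
  A m /\ lbound A m.

(* Since the library has no concave functions: f is concave iff -f is convex. *)
Definition concave_function (R : realType) (f : R -> R) : Prop :=
  convex_function [set: R^o] (fun a : R^o => - f a).

(* Only the values on [0, +oo[ matter; nonnegativity there follows. *)
Definition modulus_of_continuity (R : realType) (eta : R -> R) : Prop :=
  [/\ {in `[0, +oo[ &, {homo eta : s t / s <= t}}, eta 0 = 0 &
      eta @ 0^'+ --> eta 0].

Section Cost.
Context (R : realType) (X : pmetricType R).
Implicit Types (l : X -> X -> R -> R -> R) (ell : X -> X -> R).

Definition uncurry4 (f : X -> X -> R -> R -> R) (p : X * X * R * R) : R :=
  f p.1.1.1 p.1.1.2 p.1.2 p.2.

Definition partial_u l (z x : X) (u v : R) : R := derive1 (fun a : R => l z x a v) u.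
Definition partial_v l (z x : X) (u v : R) : R := derive1 (fun b : R => l z x u b) v.

Definition has_partial_u l (z x : X) (u v : R) : Prop :=
  derivable (fun a : R => l z x a v) u 1.
Definition has_partial_v l (z x : X) (u v : R) : Prop :=
  derivable (fun b : R => l z x u b) v 1.

Definition cost_lipschitz l (ku kv : R) : Prop :=
  (forall z x v, ku.-lipschitz (fun a : R => l z x a v : R)) /\
  (forall z x u, kv.-lipschitz (fun b : R => l z x u b : R)).

Definition cost_nonincreasing l : Prop :=
  (forall z x v, nonincreasing_fun (fun a : R => l z x a v)) /\
  (forall z x u, nonincreasing_fun (fun b : R => l z x u b)).

Definition cost_expansion l (eta : R -> R) : Prop :=
  (forall z x, has_partial_u l z x 0 0 /\ has_partial_v l z x 0 0) /\
  (forall z x u v,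
     `| l z x u v - l z x 0 0 - partial_u l z x 0 0 * u
        - partial_v l z x 0 0 * v |
     <= (`|u| + `|v|) / 2 * eta ((`|u| + `|v|) / 2)).

Definition has_weak_kam_solution ell (c : R) : Prop :=
  exists u : X -> R, continuous u /\
    forall x, is_min (range (fun y => u y + ell y x)) (u x - c).

Definition is_critical_constant ell (c : R) : Prop :=
  unique (has_weak_kam_solution ell) c.

Definition is_mather_measure ell (c : R)
    (mu : probability (borel (X * X)%type) R) : Prop :=
  (forall A : set (borel X), measurable A ->
     pushforward mu (fst : borel (X * X)%type -> borel X) A =
     pushforward mu (snd : borel (X * X)%type -> borel X) A) /\
  (\int[mu]_p (ell p.1 p.2)%:E = (- c)%:E)%E.

Definition mather_negative l (c : R) : Prop :=
  forall mu : probability (borel (X * X)%type) R,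
    is_mather_measure (fun z x => l z x 0 0) c mu ->
    (\int[mu]_p (partial_u l p.1 p.2 0 0 + partial_v l p.1 p.2 0 0)%:E < 0)%E.

(* The unique continuous solution psi of the implicit equation; the default
   value is never used when the cost is continuous, phi is continuous,
   X is compact and lam * kv < 1. *)
Definition lax_oleinik l (lam : R) (phi : X -> R) : X -> R :=
  xget (fun=> 0) [set psi : X -> R | continuous psi /\
    forall x, is_min
      (range (fun z => phi z + l z x (lam * phi z) (lam * psi x))) (psi x)].

Definition cost_concave l : Prop :=
  (forall z x v, concave_function (fun a : R => l z x a v)) /\
  (forall z x u, concave_function (fun b : R => l z x u b)).

Definition cost_C1_near0 l : Prop :=
  exists2 delta : R, 0 < delta &
  [/\ (forall z x u v, `|u| < delta -> `|v| < delta ->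
         has_partial_u l z x u v /\ has_partial_v l z x u v),
      {within [set p : X * X * R * R | `|p.1.2| < delta /\ `|p.2| < delta],
        continuous (uncurry4 (partial_u l))} &
      {within [set p : X * X * R * R | `|p.1.2| < delta /\ `|p.2| < delta],
        continuous (uncurry4 (partial_v l))}].

End Cost.

(* Main.v *)
(** A fixed point of [T_lambda] is a solution of
    [u x = min_z (u z + l z x (lambda u z) (lambda u x))].  Existence is
    Knaster-Tarski between [u0 - C <= 0] and [u0 + C >= 0], where [u0] is a weak
    KAM solution: monotonicity of [l] makes them a sub- and a supersolution.

    For uniqueness, follow backward from [x] a chain [y] of minimizers.  Empirical
    measures of long chains with small average cost [l0] accumulate at Mather
    measures, so (l4) gives [e0 > 0] such that the average of [d_u l + d_v l] at
    [(0,0)] along such a chain is at most [- e0].  The limit measure is the Riesz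
    measure of an ultrafilter limit of the empirical averages.  Applied to chains
    of [u] and of [u0], this bounds fixed points uniformly in small [lambda].  If
    [u] and [w] are two of them and [w x > u x], then along the chain of [u] the
    difference [D i = w (y i) - u (y i)] stays positive and
    [D (i+1) >= D i - lambda (d_u l + d_v l + e0/2) D i], because (1) or (2) bounds
    the secants of [l] near [(0,0)] from above; hence [D] is unbounded, which is
    absurd. *)
From HB Require Import structures.
Require Import Defs.
From mathcomp Require Import all_boot all_order all_algebra.
From mathcomp Require Import all_classical all_reals all_analysis.
From mathcomp Require Import measurable_realfun ring lra.

Import Order.TTheory GRing.Theory Num.Theory.
Import numFieldNormedType.Exports.

Local Open Scope classical_set_scope.
Local Open Scope ring_scope.

Set Implicit Arguments.
Unset Strict Implicit.
Unset Printing Implicit Defensive.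

(** * Riesz representation on a compact pseudometric space *)

Section Borel.
Context (R : realType).

Lemma continuous_borel_measurable (K : pseudoPMetricType R) (f : K -> R) :
  continuous f -> measurable_fun [set: borel K] (f : borel K -> R).
Proof.
move=> cf; refine (@measurability _ _ (borel K) R setT f _
  (measurable_realfun.RGenOpens.measurableE R) _) => _ [_ [x [y ->]] <-].
rewrite setTI; apply: sub_sigma_algebra.
by apply: open_comp; [move=> z _; exact: cf|exact: interval_open].
Qed.

Lemma continuous_borel_measurable_map (K T : pseudoPMetricType R)
    (f : K -> T) :
  continuous f -> measurable_fun [set: borel K] (f : borel K -> borel T).
Proof.
move=> cf; refine (@measurability _ _ (borel K) (borel T) setT f
  (open : set (set T)) _ _) => //.
move=> _ [E oE <-]; rewrite setTI; apply: sub_sigma_algebra.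
by apply: open_comp => // x _; exact: cf.
Qed.

Lemma compact_bounded_fun (K : topologicalType) (f : K -> R) :
  compact [set: K] -> continuous f -> exists2 M, 0 < M & forall x, `|f x| <= M.
Proof.
move=> cK cf; have := continuous_compact (continuous_subspaceT cf) cK.
move=> /compact_bounded/ex_strict_bound_gt0[M M0 HM].
by exists M => // x; apply/ltW/HM; exists x.
Qed.

End Borel.

(** * Open sets as cozero sets of continuous functions *)

Section PerfectlyNormal.
Context (R : realType) (K : pseudoMetricType R).

(** Plays the role of the distance to the complement of [E], truncated at 1 and expressed through
    balls only. The guard [0 < r] keeps 0 among the radii for every [x], so the supremum is over a
    nonempty set. *)
Definition cozero_dist (E : set K) (x : K) : R :=
  sup [set r | 0 <= r <= 1 /\ (0 < r -> forall a, ball x r a -> E a)].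

Let set_nonempty (E : set K) (x : K) :
  [set r : R | 0 <= r <= 1 /\ (0 < r -> forall a, ball x r a -> E a)] !=set0.
Proof. by exists 0; split; [rewrite lexx ler01|rewrite ltxx]. Qed.

Lemma cozero_dist_ge (E : set K) (x : K) (r : R) : 0 <= r <= 1 ->
  (0 < r -> forall a, ball x r a -> E a) -> r <= cozero_dist E x.
Proof.
move=> r01 rE; apply: sup_upper_bound => //; split; first by exists r.
by exists 1 => s [/andP[_ s1] _].
Qed.

Lemma cozero_dist_le (E : set K) (x : K) (b : R) : 0 <= b ->
  (forall r, 0 < r <= 1 -> (forall a, ball x r a -> E a) -> r <= b) ->
  cozero_dist E x <= b.
Proof.
move=> b0 H; apply: ge_sup => //= r [/andP[r0 r1] rE].
have [r0'|] := ltP 0 r; last by move=> /le_trans; apply.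
by apply: H; [rewrite r0'|exact: rE].
Qed.

Lemma cozero_dist_ge0 (E : set K) (x : K) : 0 <= cozero_dist E x.
Proof. by apply: cozero_dist_ge; rewrite ?lexx ?ler01// ltxx. Qed.

(** The function is 1-Lipschitz: if [ball x e y], the ball of radius [r - e] at [y] lies in the ball
    of radius [r] at [x]. *)
Lemma cozero_dist_continuous (E : set K) : continuous (cozero_dist E).
Proof.
have key (x y : K) (e : R) : 0 < e -> ball x e y ->
    cozero_dist E x <= cozero_dist E y + e.
  move=> e0 xy; apply: cozero_dist_le => [|r /andP[r0 r1] rE].
    by rewrite addr_ge0 ?cozero_dist_ge0// ltW.
  have [re|er] := leP r e; first by have := cozero_dist_ge0 E y; lra.
  rewrite -lerBlDr; apply: cozero_dist_ge; first by apply/andP; split; lra.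
  move=> _ a ya; apply: rE; have := ball_triangle xy ya.
  by rewrite addrC subrK.
move=> x; apply/cvgrPdist_le => e e0; near=> y.
have xy : ball x e y by near: y; exact: nbhsx_ballx.
have := key _ _ _ e0 xy; have := key _ _ _ e0 (ball_sym xy).
by rewrite ler_distl => ? ?; apply/andP; split; lra.
Unshelve. all: by end_near. Qed.

Lemma cozero_dist_gt0 (E : set K) (x : K) : open E ->
  0 < cozero_dist E x <-> E x.
Proof.
move=> oE; split=> [d0|Ex].
  have [r [/andP[r0 _] rE] r0'] := sup_gt (set_nonempty E x) d0.
  by apply: rE => //; exact: ballxx.
have /nbhs_ballP[r /= r0 rE] : nbhs x E by exact: open_nbhs_nbhs.
apply: (@lt_le_trans _ _ (Num.min r 1)); first by rewrite lt_min r0 ltr01.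
apply: cozero_dist_ge; first by rewrite ge_min lexx orbT andbT le_min ltW//= ler01.
by move=> _ a xa; apply: rE; apply: le_ball xa; rewrite ge_min lexx.
Qed.

End PerfectlyNormal.

(** * The measure of a normalized positive functional, by Caratheodory's construction *)

Section Riesz.
Context (R : realType) (K : pseudoPMetricType R).

Definition normalized_positive (L : (K -> R) -> R) : Prop :=
  [/\ forall f g : K -> R, continuous f -> continuous g ->
        L (fun x => f x + g x) = L f + L g,
      forall (c : R) (f : K -> R), continuous f -> L (fun x => c * f x) = c * L f,
      forall f g : K -> R, continuous f -> continuous g -> (forall x, f x <= g x) ->
        L f <= L g &
      L (fun=> 1) = 1].

Context (L : (K -> R) -> R) (L_pos : normalized_positive L)

  (K_compact : compact [set: K]).

Let LD (f g : K -> R) : continuous f -> continuous g ->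
  L (fun x => f x + g x) = L f + L g.
Proof. by case: L_pos => H _ _ _; exact: H. Qed.
Let LZ (c : R) (f : K -> R) : continuous f -> L (fun x => c * f x) = c * L f.
Proof. by case: L_pos => _ H _ _; exact: H. Qed.
Let Lle (f g : K -> R) : continuous f -> continuous g -> (forall x, f x <= g x) ->
  L f <= L g.
Proof. by case: L_pos => _ _ H _; exact: H. Qed.
Let L1 : L (fun=> 1) = 1.
Proof. by case: L_pos. Qed.

Let Lcst c : L (fun=> c) = c.
Proof.
have c1 : continuous (fun _ : K => 1 : R) by move=> x; exact: cvg_cst.
by have := LZ c c1; rewrite L1 mulr1.
Qed.

Let Lge0 (f : K -> R) : continuous f -> (forall x, 0 <= f x) -> 0 <= L f.
Proof. by move=> cf f0; rewrite -(Lcst 0); apply: Lle => // x; exact: cvg_cst. Qed.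

Let Lsum (n : nat) (f : nat -> K -> R) : (forall k, continuous (f k)) ->
  continuous (fun x => \sum_(i < n) f i x) /\
  L (fun x => \sum_(i < n) f i x) = \sum_(i < n) L (f i).
Proof.
move=> cf; elim: n => [|n [IHc IH]].
  under eq_fun do rewrite big_ord0.
  by rewrite big_ord0 Lcst; split=> // x; exact: cvg_cst.
under eq_fun do rewrite big_ord_recr/=.
split; first by move=> x; apply: cvgD; [exact: IHc|exact: cf].
by rewrite LD// IH big_ord_recr.
Qed.

(* Majorants are suprema of nondecreasing sequences of continuous functions:
   countable subadditivity then needs no double series. *)
Definition majorized (A : set K) (s : R) : Prop := exists g : nat -> K -> R,
  [/\ forall n, continuous (g n), forall n x, 0 <= g n x,
      forall n m x, (n <= m)%N -> g n x <= g m x, forall n, L (g n) <= s &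
      forall x c, A x -> c < 1 -> exists n, c < g n x].

Definition riesz_outer (A : set K) : R := inf [set s | majorized A s].

Let maj1 A : majorized A 1.
Proof.
exists (fun _ _ => 1); split=> //; first by move=> n x; exact: cvg_cst.
- by move=> n; rewrite L1.
- by move=> x c _ c1; exists 0%N.
Qed.

Let maj_ge0 A s : majorized A s -> 0 <= s.
Proof. by case=> g [cg g0 _ /(_ 0%N) gs _]; apply: le_trans gs; exact: Lge0. Qed.

Let has_inf_maj A : has_inf [set s | majorized A s].
Proof. by split; [exists 1; exact: maj1|exists 0 => s; exact: maj_ge0]. Qed.

Lemma riesz_outer_le A s : majorized A s -> riesz_outer A <= s.
Proof. by move=> As; apply: inf_lbound => //; case: (has_inf_maj A). Qed.

Lemma le_riesz_outer A b : (forall s, majorized A s -> b <= s) ->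
  b <= riesz_outer A.
Proof. by move=> H; apply: lb_le_inf => //; exists 1; exact: maj1. Qed.

Lemma riesz_outer_ge0 A : 0 <= riesz_outer A.
Proof. by apply: le_riesz_outer => s; exact: maj_ge0. Qed.

Lemma riesz_outer_closed A (f : K -> R) : continuous f -> (forall x, 0 <= f x) ->
  (forall x, A x -> 1 <= f x) -> riesz_outer A <= L f.
Proof.
move=> cf f0 Af; apply: riesz_outer_le; exists (fun=> f); split=> //.
by move=> x c Ax c1; exists 0%N; apply: lt_le_trans (Af x Ax).
Qed.

(** Dini's argument: by compactness and monotonicity in [n], a single [g n] of a majorant exceeds
    [1 - e] on all of [K], so [L (g n) >= 1 - e]. *)
Lemma riesz_outerT : riesz_outer [set: K] = 1.
Proof.
apply/eqP; rewrite eq_le riesz_outer_le ?maj1//=.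
apply: le_riesz_outer => s [g [cg g0 gnd gs gc]].
apply/ler_addgt0Pr => e e0; rewrite -lerBlDr.
have /compact_near_coveringP/(_ nat \oo (fun n x => 1 - e < g n x)) := K_compact.
case=> [|n _ H].
  move=> x _; have [|n gn] := gc x (1 - e) I; first by rewrite gtrBl.
  have : \forall x' \near x, 1 - e < g n x' by apply: (cvgr_gt _ (cg n x)).
  move=> near_g; exists ([set x' | 1 - e < g n x'], [set m | (n <= m)%N]).
    by split => //=; exists n.
  by move=> [x' m] [/= + nm] => /lt_le_trans; apply; exact: gnd.
have {}H x : 1 - e < g n x by apply: H => /=.
rewrite -(Lcst (1 - e)); apply: le_trans (gs n); apply: Lle => //.
  by move=> x; exact: cvg_cst.
by move=> x; exact: ltW.
Qed.

Let mu (A : set K) : \bar R := (riesz_outer A)%:E.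

Let mu0 : mu set0 = 0%E.
Proof.
congr EFin; apply/eqP; rewrite eq_le riesz_outer_ge0 andbT.
rewrite -(Lcst 0); apply: riesz_outer_closed => //.
by move=> x; exact: cvg_cst.
Qed.

Let mu_ge0 A : (0 <= mu A)%E.
Proof. by rewrite lee_fin riesz_outer_ge0. Qed.

Let mu_le : {homo mu : A B / A `<=` B >-> (A <= B)%E}.
Proof.
move=> A B AB; rewrite lee_fin; apply: le_riesz_outer => s [g [? ? ? ? gc]].
by apply: riesz_outer_le; exists g; split=> // x c /AB; exact: gc.
Qed.

(** Near-optimal majorants [G k] of [F k], with slack [e / 2 ^+ k.+1], are summed along the
    diagonal: the sum of [G i n] over [i <= n] is nondecreasing in [n], and on [F k] it eventually
    dominates [G k]. *)
Let mu_sub : sigma_subadditive mu.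
Proof.
move=> F; have [->|] := eqVneq (\sum_(i <oo) mu (F i))%E +oo%E.
  by rewrite leey.
rewrite -ltey => foo.
have S0 : (0 <= \sum_(i <oo) mu (F i))%E by exact: nneseries_ge0.
have [S SE] : exists S : R, (\sum_(i <oo) mu (F i))%E = S%:E.
  exists (fine (\sum_(i <oo) mu (F i))%E).
  by rewrite fineK// ge0_fin_numE.
have Sle n : \sum_(i < n) riesz_outer (F i) <= S.
  rewrite -lee_fin -SE -sumEFin.
  apply: le_trans (nneseries_lim_ge n _) => //.
  by rewrite big_mkord.
rewrite SE lee_fin; apply/ler_addgt0Pr => e e0.
have eps k : 0 < e / 2 ^+ k.+1 by rewrite divr_gt0// exprn_gt0.
have {}eps k : exists2 s, majorized (F k) s & s < riesz_outer (F k) + e / 2 ^+ k.+1.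
  have [s Hs1 Hs2] := inf_adherent (eps k) (has_inf_maj (F k)).
  by exists s.
have /choice[G HG] : forall k, exists g : nat -> K -> R,
  [/\ forall n, continuous (g n), forall n x, 0 <= g n x,
      forall n m x, (n <= m)%N -> g n x <= g m x,
      forall n, L (g n) <= riesz_outer (F k) + e / 2 ^+ k.+1 &
      forall x c, F k x -> c < 1 -> exists n, c < g n x].
  move=> k; have [s [g [? ? ? gs ?]] se] := eps k.
  by exists g; split=> // n; apply: le_trans (gs n) _; exact: ltW.
apply: riesz_outer_le; exists (fun n x => \sum_(i < n.+1) G i n x); split.
- by move=> n; have [] := @Lsum n.+1 (fun i => G i n) (fun k => let: And5 c _ _ _ _ := HG k in c n).
- by move=> n x; apply: sumr_ge0 => i _; have [_ + _ _ _] := HG i; exact.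
- move=> n m x nm.
  have : \sum_(i < n.+1) G i n x <= \sum_(i < n.+1) G i m x.
    by apply: ler_sum => i _; have [_ _ + _ _] := HG i; apply.
  move=> /le_trans; apply; rewrite -!(big_mkord xpredT (fun i => G i m x)).
  rewrite (big_cat_nat (n := n.+1) (p := m.+1))//= lerDl.
  by apply: sumr_ge0 => i _; have [_ + _ _ _] := HG i; exact.
- move=> n; have [_ ->] := @Lsum n.+1 (fun i => G i n) (fun k => let: And5 c _ _ _ _ := HG k in c n).
  apply: (@le_trans _ _ (\sum_(i < n.+1) (riesz_outer (F i) + e / 2 ^+ i.+1))).
    by apply: ler_sum => i _; have [_ _ _ + _] := HG i; exact.
  rewrite big_split/= lerD ?Sle//.
  suff -> : \sum_(i < n.+1) e / 2 ^+ i.+1 = e - e / 2 ^+ n.+1.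
    by rewrite gerBl divr_ge0 ?exprn_ge0// ltW.
  elim: n => [|n IH]; first by rewrite big_ord1; lra.
  have E : e / 2 ^+ n.+1 = 2 * (e / 2 ^+ n.+2).
    by rewrite (exprS 2 n.+1) invfM; lra.
  by rewrite big_ord_recr/= IH E; lra.
- move=> x c [k _ Fkx] c1; have [_ g0 gnd _ /(_ x c Fkx c1)[n cn]] := HG k.
  exists (maxn n k); apply: (lt_le_trans cn).
  apply: (@le_trans _ _ (G k (maxn n k) x)); first by apply: gnd; exact: leq_maxl.
  have kn : (k < (maxn n k).+1)%N by rewrite ltnS leq_maxr.
  rewrite (bigD1 (Ordinal kn))//= lerDl; apply: sumr_ge0 => i _.
  by have [_ + _ _ _] := HG i; exact.
Qed.

HB.instance Definition _ := isOuterMeasure.Build R K mu mu0 mu_ge0 mu_le mu_sub.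

Let open_cara (E : set K) : open E -> mu.-caratheodory E.
Proof.
move=> oE; apply: le_caratheodory_measurable => A.
rewrite -EFinD lee_fin; apply: le_riesz_outer => s [g [cg g0 gnd gs gc]].
(* [chi k] increases to the indicator of [E]: if [g] majorizes [A] then
   [n |-> g n * chi n] majorizes [A `&` E], and, for every fixed [k],
   [n |-> g n * (1 - chi k)] majorizes [A `\` E]. *)
pose chi k x : R := Num.min 1 (k%:R * cozero_dist E x).
have cchi k : continuous (chi k).
  move=> x; apply: (@continuous_min _ _ (fun=> 1)
    (fun y => k%:R * cozero_dist E y)); first exact: cvg_cst.
  by apply: cvgMl_tmp; exact: cozero_dist_continuous.
have chi1 k x : chi k x <= 1 by rewrite ge_min lexx.
have chi0 k x : 0 <= chi k x.
  by rewrite le_min ler01 mulr_ge0// cozero_dist_ge0.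
have chind k m x : (k <= m)%N -> chi k x <= chi m x.
  move=> km; apply: le_min2 => //; rewrite ler_wpM2r ?cozero_dist_ge0//.
  by rewrite ler_nat.
have gchi n k : continuous (fun x => g n x * chi k x).
  by move=> x; apply: cvgM; [exact: cg|exact: cchi].
have gchi' n k : continuous (fun x => g n x * (1 - chi k x)).
  move=> x; apply: cvgM; first exact: cg.
  by apply: cvgB; [exact: cvg_cst|exact: cchi].
have out k : riesz_outer (A `&` ~` E) <= s - L (fun x => g k x * chi k x).
  apply: riesz_outer_le; exists (fun n x => g n x * (1 - chi k x)); split=> //.
  - by move=> n x; rewrite mulr_ge0// subr_ge0.
  - by move=> n m x nm; rewrite ler_wpM2r ?subr_ge0//; exact: gnd.
  (* The weights [chi k] and [1 - chi k] add up to 1, so the two products fit together under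
     [g (maxn n k)]. *)
  - move=> n; rewrite lerBrDr -LD//; apply: le_trans (gs (maxn n k)).
    apply: Lle => // [x|x]; first by apply: cvgD; [exact: gchi'|exact: gchi].
    have := gnd _ _ x (leq_maxl n k); have := gnd _ _ x (leq_maxr n k).
    move=> H1 H2; have := chi0 k x; have := chi1 k x => H3 H4.
    by nra.
  - move=> x c [Ax nEx] c1; have [n cn] := gc x c Ax c1.
    exists n; suff -> : chi k x = 0 by rewrite subr0 mulr1.
    have d0 : cozero_dist E x = 0.
      apply/eqP; rewrite eq_le cozero_dist_ge0 andbT leNgt.
      by apply/negP => /(cozero_dist_gt0 _ oE).
    by rewrite /chi d0 mulr0 min_r.
(* Read for every [k], [out] is the bound on [L] required of this majorant of the intersection of
   [A] and [E]. *)
rewrite -lerBrDr; apply: riesz_outer_le.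
exists (fun k x => g k x * chi k x); split=> //.
- by move=> k x; rewrite mulr_ge0.
- move=> n m x nm; apply: ler_pM => //; [exact: gnd|exact: chind].
- by move=> n; have := out n; lra.
- move=> x c [Ax Ex] c1; have [n cn] := gc x c Ax c1.
  have /(cozero_dist_gt0 _ oE) d0 := Ex.
  have [m Hm] : exists m : nat, 1 <= m%:R * cozero_dist E x.
    exists (Num.bound (cozero_dist E x)^-1); rewrite -ler_pdivrMr// div1r.
    by apply/ltW/archi_boundP; rewrite invr_ge0 cozero_dist_ge0.
  exists (maxn n m).
  have -> : chi (maxn n m) x = 1.
    apply: min_l; apply: le_trans Hm _; rewrite ler_wpM2r ?cozero_dist_ge0//.
    by rewrite ler_nat leq_maxr.
  by rewrite mulr1; apply: lt_le_trans cn _; apply: gnd; exact: leq_maxl.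
Qed.

Lemma exists_riesz_measure : exists P : probability (borel K) R,
  forall A, P A = (riesz_outer A)%:E.
Proof.
have cara (A : set (borel K)) : measurable A -> mu.-cara.-measurable A.
  (* Measurability of the identity from the Caratheodory sets to the Borel sets says that Borel sets
     are Caratheodory measurable; it can be tested on open sets. *)
  move=> mA; pose id' : caratheodory_type mu -> borel K := id.
  have mid : measurable_fun [set: caratheodory_type mu] id'.
    refine (@measurability _ _ (caratheodory_type mu) (borel K) setT id'
      (open : set (set K)) _ _) => //.
    by move=> _ [E oE <-]; rewrite setTI; exact: open_cara.
  by have := mid measurableT A mA; rewrite setTI.
pose nu : set (borel K) -> \bar R := mu.
have nu_sigma : semi_sigma_additive nu.
  move=> F mF tF mUF.
  have := @caratheodory_measure_sigma_additive _ _ mu F.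
  by apply=> // [n|]; exact: cara.
have nu1 : nu setT = 1%E by rewrite /nu /mu riesz_outerT.
pose M := isMeasure.Build _ _ _ nu mu0 mu_ge0 nu_sigma.
pose m : measure (borel K) R := HB.pack_for (measure (borel K) R) nu M.
pose M1 := Measure_isProbability.Build _ _ _ m nu1.
pose P : probability (borel K) R := HB.pack_for (probability (borel K) R) nu M M1.
by exists P.
Qed.

(** For [y >= 0], [clip (y - i%:R)] is the share of [y] between the levels [i] and [i + 1]. *)
Let clip (t : R) : R := Num.max 0 (Num.min 1 t).

Let clip_sum (y : R) n : 0 <= y ->
  \sum_(i < n) clip (y - i%:R) = Num.min y n%:R.
Proof.
move=> y0; elim: n => [|n IH]; first by rewrite big_ord0 min_r.
rewrite big_ord_recr/= IH /clip -natr1.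
have [H1|H1] := leP y n%:R.
  by rewrite min_r ?max_l ?min_l; lra.
have [H2|H2] := leP (n%:R + 1) y; last first.
  by rewrite min_r ?max_r; lra.
by rewrite min_l ?max_r; lra.
Qed.

(** The right-hand side counts the integers from 1 to [n] that are at most [y]; rounding down costs
    at most 1. *)
Let level_sum (y : R) n :
  Num.min (y - 1) n%:R <= \sum_(i < n) ((i.+1%:R <= y)%R%:R : R).
Proof.
elim: n => [|n IH]; first by rewrite big_ord0 ge_min lexx orbT.
rewrite big_ord_recr/= -natr1; move: IH.
set S := \sum_(i < n) _ => IH.
have [H|H] := leP (n%:R + 1) y.
  rewrite [in X in _ <= X]/=.
  move: IH; rewrite min_r; last by lra.
  by move=> IH; rewrite ge_min; apply/orP; right; lra.
move: IH; rewrite ge_min => /orP[IH|IH]; rewrite ge_min; apply/orP; left; rewrite addr0; lra.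
Qed.

Context (P : probability (borel K) R) (PE : forall A, P A = (riesz_outer A)%:E).

Let integral_cst1 (c : R) : (\int[P]_(x in [set: borel K]) c%:E = c%:E)%E.
Proof.
rewrite integral_cst//; transitivity (c%:E * 1)%E; last by rewrite mule1.
congr (_ * _)%E; exact: probability_setT.
Qed.

Let bounded_integrable (f : K -> R) : continuous f ->
  P.-integrable [set: borel K] (EFin \o f).
Proof.
move=> cf; apply: measurable_bounded_integrable => //.
- exact: (le_lt_trans (probability_le1 P measurableT) (ltry 1)).
- exact: continuous_borel_measurable.
- have [M M0 HM] := compact_bounded_fun K_compact cf.
  exists M; split; first exact: gtr0_real.
  by move=> M' MM' x _; apply: le_trans (HM x) _; exact: ltW.
Qed.

(* Layer cake with [N] levels, [1 / N < e]: [f] exceeds by at most [1 / N] the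
   average of the indicators of [i + 1 <= N f], each of which is below
   [clip (N f - i)], and these clips add up to [N f]. *)
Let integral_le01 (f : K -> R) : continuous f -> (forall x, 0 <= f x <= 1) ->
  (\int[P]_x (f x)%:E <= (L f)%:E)%E.
Proof.
move=> cf f01; apply/lee_addgt0Pr => e e0.
pose N := (Num.bound e^-1).
have eN : e^-1 < N%:R by apply: archi_boundP; rewrite invr_ge0 ltW.
have N0 : (0 : R) < N%:R by apply: lt_trans eN; rewrite invr_gt0.
pose A i : set (borel K) := [set x | i.+1%:R <= N%:R * f x].
have mA i : measurable (A i).
  rewrite -[A i]setCK; apply: measurableC; apply: sub_sigma_algebra.
  have -> : ~` A i = (fun x => N%:R * f x) @^-1` [set y | y < i.+1%:R].
    by apply/seteqP; split => x /=; rewrite /A/= ltNge => /negP.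
  apply: open_comp => // x _; apply: cvgMl_tmp; exact: cf.
have cg i : continuous (fun x => clip (N%:R * f x - i%:R)).
  move=> x; apply: (@continuous_max _ _ (fun=> 0)
    (fun y => Num.min 1 (N%:R * f y - i%:R))); first exact: cvg_cst.
  apply: (@continuous_min _ _ (fun=> 1)
    (fun y => (N%:R * f y - i%:R))); first exact: cvg_cst.
  by apply: cvgB; [apply: cvgMl_tmp; exact: cf|exact: cvg_cst].
have PA i : (P (A i) <= (L (fun x => clip (N%:R * f x - i%:R))%R)%:E)%E.
  rewrite PE lee_fin; apply: riesz_outer_closed => // x.
    by rewrite /clip le_max lexx.
  rewrite /A/= /clip => Ax; rewrite le_max le_min lexx/=.
  by rewrite lerBrDr addrC natr1 Ax orbT.
have LE : L f = N%:R^-1 * \sum_(i < N) L (fun x => clip (N%:R * f x - i%:R)).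
  have [_ <-] := @Lsum N (fun i x => clip (N%:R * f x - i%:R)) cg.
  have -> : (fun x => \sum_(i < N) clip (N%:R * f x - i%:R)) = (fun x => N%:R * f x).
    apply/funext => x; rewrite clip_sum; last first.
      by rewrite mulr_ge0//; case/andP: (f01 x).
    rewrite min_l// ger_pMr//; by case/andP: (f01 x).
  by rewrite LZ// mulrA mulVf ?mul1r// gt_eqF.
pose S : borel K -> \bar R := fun x => (\sum_(i < N) (\1_(A i) x)%:E)%E.
pose h : borel K -> \bar R := fun x => ((N%:R^-1)%:E * (1 + S x))%E.
have hs x : h x = (N%:R^-1 * (1 + \sum_(i < N) \1_(A i) x))%:E.
  by rewrite /h /S sumEFin -EFinD -EFinM.
pose one_A i : borel K -> \bar R := fun x => (\1_(A i) x)%:E.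
have m1 i : measurable_fun [set: borel K] (one_A i).
  by apply/measurable_EFinP; exact: measurable_indic.
have mS : measurable_fun [set: borel K] S.
  exact: (emeasurable_sum (index_enum 'I_N) (fun i => m1 (nat_of_ord i))).
have S0 x : (0 <= S x)%E by apply: sume_ge0 => i _; rewrite lee_fin.
apply: (@le_trans _ _ (\int[P]_x h x)%E).
  apply: ge0_le_integral => //.
  - by move=> x _; rewrite lee_fin; case/andP: (f01 x).
  - by apply/measurable_EFinP; exact: continuous_borel_measurable.
  - apply: measurable_funeM; apply: emeasurable_funD => //.
  - move=> x _; rewrite hs lee_fin ler_pdivlMl//.
    have := level_sum (N%:R * f x) N; rewrite min_l; last first.
      have /andP[_ f1] := f01 x.
      have : N%:R * f x <= N%:R by rewrite ger_pMr.
      lra.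
    rewrite lerBlDl => /le_trans; apply; rewrite lerD2l.
    apply: ler_sum => i _; rewrite indicE.
    have [H|H] := boolP (i.+1%:R <= N%:R * f x); [by rewrite mem_set|exact: ler0n].
rewrite ge0_integralZl//; last 2 first.
- by apply: emeasurable_funD.
- by move=> x _; rewrite adde_ge0.
rewrite ge0_integralD//.
rewrite (integral_cst1 1).
rewrite ge0_integral_sum//; last by move=> i; exact: m1.
apply: (@le_trans _ _ ((N%:R^-1)%:E * (1 +
    (\sum_(i < N) L (fun x => clip (N%:R * f x - i%:R)))%:E))%E).
  rewrite lee_pmul2l// ?lte_fin ?invr_gt0// leeD2l// -sumEFin.
  apply: lee_sum => i _; rewrite /one_A integral_indic//.
  by have := PA i; rewrite -{1}[A i]setIT.
rewrite -EFinD -EFinM -EFinD lee_fin mulrDr mulr1 -LE addrC lerD2l.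
by rewrite invf_ple// ?posrE// ltW.
Qed.

(** An affine change of [f] takes values in [[0, 1]], where [integral_le01] applies. *)
Let integral_le (f : K -> R) : continuous f ->
  (\int[P]_x (f x)%:E <= (L f)%:E)%E.
Proof.
move=> cf; have [M M0 HM] := compact_bounded_fun K_compact cf.
pose h : K -> R := fun x => (2 * M)^-1 * (f x + M).
have M2 : 0 < 2 * M by rewrite mulr_gt0.
have cfM : continuous (fun x => f x + M).
  by move=> x; apply: cvgD; [exact: cf|exact: cvg_cst].
have ch : continuous h by move=> x; apply: cvgMl_tmp; exact: cfM.
have h01 x : 0 <= h x <= 1.
  have := HM x; rewrite ler_norml => /andP[H1 H2].
  rewrite /h mulr_ge0 ?invr_ge0 ?ler_pdivrMl//=; lra.
have cM : continuous (fun _ : K => M : R) by move=> x; exact: cvg_cst.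
have := integral_le01 ch h01.
have -> : L h = (2 * M)^-1 * (L f + M).
  by rewrite LZ// LD// Lcst.
have -> : (\int[P]_x (h x)%:E = ((2 * M)^-1)%:E * (\int[P]_x (f x)%:E + M%:E))%E.
  rewrite /h; under eq_integral do rewrite EFinM.
  rewrite integralZl//; last exact: (bounded_integrable cfM).
  congr (_ * _)%E; under eq_integral do rewrite EFinD.
  rewrite integralD//; first by rewrite integral_cst1.
    exact: (bounded_integrable cf).
  exact: (bounded_integrable cM).
rewrite EFinM lee_pmul2l// ?lte_fin ?invr_gt0//.
by rewrite EFinD leeD2rE.
Qed.

(** The inequality [integral_le] for [f] and for [- f]. *)
Lemma riesz_integral (f : K -> R) : continuous f ->
  (\int[P]_x (f x)%:E = (L f)%:E)%E.
Proof.
move=> cf; apply/eqP; rewrite eq_le integral_le//=.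
have cN : continuous (fun x => -1 * f x).
  by move=> x; apply: cvgMl_tmp; exact: cf.
have := integral_le cN; rewrite LZ// mulN1r.
under eq_integral do rewrite mulN1r EFinN.
rewrite integralN; last exact: integrable_add_def (bounded_integrable cf).
by rewrite EFinN leeN2.
Qed.

End Riesz.

Theorem riesz_representation (R : realType) (K : pseudoPMetricType R)
    (L : (K -> R) -> R) :
  normalized_positive L -> compact [set: K] ->
  exists P : probability (borel K) R,
    forall f, continuous f -> (\int[P]_x (f x)%:E = (L f)%:E)%E.
Proof.
move=> L_pos cK; have [P PE] := exists_riesz_measure L_pos cK.
by exists P => f; exact: riesz_integral PE f.
Qed.

(** * Equality of image measures tested on continuous functions *)

Section Marginals.
Context (R : realType).

(** Monotone convergence: [Num.min 1 (k%:R * d x)] increases to the indicator of the cozero set.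
    Integrals of continuous functions thus determine the measure of open sets. *)
Lemma cvg_integral_cozero (K : pseudoPMetricType R)
    (P : {measure set (borel K) -> \bar R}) (d : K -> R) :
  continuous d -> (forall x, 0 <= d x) ->
  (\int[P]_x (Num.min 1 (k%:R * d x))%:E)%E @[k --> \oo]
    --> P [set x | 0 < d x].
Proof.
move=> cd d0.
have mE : measurable ([set x | 0 < d x] : set (borel K)).
  apply: sub_sigma_algebra; apply: (@open_comp _ _ d [set y | 0 < y]).
    by move=> x _; exact: cd.
  exact: open_gt.
have mf k : measurable_fun [set: borel K]
    (fun x : borel K => (Num.min 1 (k%:R * d x))%:E).
  apply/measurable_EFinP.
  apply: (@continuous_borel_measurable _ K (fun x => Num.min 1 (k%:R * d x))).
  move=> x; apply: (@continuous_min _ _ (fun=> 1) (fun y => k%:R * d y)).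
    exact: cvg_cst.
  by apply: cvgMl_tmp; exact: cd.
rewrite -[X in _ --> P X]setIT -(integral_indic P measurableT mE).
have -> : (\int[P]_x (\1_[set y | (0 < d y)%R] x)%:E)%E =
    (\int[P]_x (limn (fun k => (Num.min 1 (k%:R * d x))%:E)))%E.
  apply: eq_integral => x _; apply/esym/cvg_lim => //.
  rewrite indicE; have [dx|dx] := ltP 0 (d x).
    rewrite mem_set//=; apply: cvg_near_cst.
    near=> k; congr EFin; apply: min_l.
    rewrite -ler_pdivrMr// div1r.
    apply: (@le_trans _ _ (Num.bound (d x)^-1)%:R).
      by apply/ltW/archi_boundP; rewrite invr_ge0.
    by rewrite ler_nat; near: k; exact: nbhs_infty_ge.
  rewrite memNset/=; last by rewrite ltNge dx.
  have -> : d x = 0 by apply/eqP; rewrite eq_le dx d0.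
  apply: cvg_near_cst; near=> k; by rewrite mulr0 min_r.
apply: cvg_monotone_convergence => //.
- by move=> k x _; rewrite lee_fin le_min ler01 mulr_ge0.
- move=> x _ m n mn; rewrite lee_fin le_min2// ler_wpM2r//.
  by rewrite ler_nat.
Unshelve. all: by end_near. Qed.

(** Open sets generate the Borel sets and are stable under intersection, so agreement on them
    suffices; there it follows from [cvg_integral_cozero] with [d] the function [cozero_dist E]
    composed with [f] or [g]. *)
Lemma borel_pushforward_eq (K T : pseudoPMetricType R)
    (P : probability (borel K) R) (f g : K -> T) :
  continuous f -> continuous g ->
  (forall h : T -> R, continuous h ->
    (\int[P]_x (h (f x))%:E = \int[P]_x (h (g x))%:E)%E) ->
  forall A : set (borel T), measurable A ->
    pushforward P (f : borel K -> borel T) A =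
    pushforward P (g : borel K -> borel T) A.
Proof.
move=> cf cg fg A mA.
have mf := continuous_borel_measurable_map cf.
have mg := continuous_borel_measurable_map cg.
pose m1 := measure_function_pushforward__canonical__measure_function_Measure P mf.
pose m2 := measure_function_pushforward__canonical__measure_function_Measure P mg.
apply: (@g_sigma_algebra_measure_unique _ _ (borel T) open _ (fun=> setT) _ _ m1 m2) => //.
- by move=> E oE; exact: sub_sigma_algebra.
- by move=> _; exact: openT.
- by rewrite bigcup_const.
- exact: openI.
- move=> E oE; rewrite /m1 /m2/= /pushforward.
  have cd := @cozero_dist_continuous R T E.
  have preE (h : K -> T) : h @^-1` E = [set x | 0 < cozero_dist E (h x)].
    by apply/seteqP; split => x /= /(cozero_dist_gt0 _ oE).
  rewrite !preE.
  have cc (h : K -> T) : continuous h -> continuous (fun x => cozero_dist E (h x)).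
    by move=> ch x; apply: continuous_comp; [exact: ch|exact: cd].
  have Hf := @cvg_integral_cozero K P _ (cc _ cf) (fun x => cozero_dist_ge0 E (f x)).
  have Hg := @cvg_integral_cozero K P _ (cc _ cg) (fun x => cozero_dist_ge0 E (g x)).
  rewrite -(cvg_lim (@ereal_hausdorff R) Hf) -(cvg_lim (@ereal_hausdorff R) Hg).
  congr (limn _).
  apply/funext => k.
  apply: (fg (fun y => Num.min 1 (k%:R * cozero_dist E y))) => y.
  apply: (@continuous_min _ _ (fun=> 1) (fun y => k%:R * cozero_dist E y)).
    exact: cvg_cst.
  by apply: cvgMl_tmp; exact: cd.
- move=> _; rewrite /m1/= /pushforward preimage_setT.
  exact: (le_lt_trans (probability_le1 P measurableT) (ltry 1)).
Qed.

End Marginals.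

(** * Averages along long chains *)

(* Makes [X * X] a [pseudoPMetricType]. *)
HB.saturate prod.

(** The image of [U] has a cluster point in the compact segment, and an ultrafilter converges to its
    cluster points. *)
Lemma ultra_bounded_cvg (R : realType) (U : set_system nat) (a : nat -> R)
    (M : R) : UltraFilter U -> (forall k, `|a k| <= M) ->
  exists p : R, a k @[k --> U] --> p.
Proof.
move=> UU aM; have PU : ProperFilter U by exact: ultra_proper.
have [|p [_ clp]] := @segment_compact R (- M) M (a @ U) _.
  apply: (@filterS _ U _ setT) filterT => k _.
  by rewrite /preimage/= in_itv/= -ler_norml.
exists p => V Vp; have [//|] := @in_ultra_setVsetC _ U (a @^-1` V) UU.
move=> UV; have [q []] := clp (~` V) V UV Vp.
by [].
Qed.

Lemma telescope_sum_ord (R : realType) (v : nat -> R) (n : nat) :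
  \sum_(i < n) (v i - v i.+1) = v 0%N - v n.
Proof.
elim: n => [|n IH]; first by rewrite big_ord0 subrr.
by rewrite big_ord_recr/= IH addrA subrK.
Qed.

Section ChainAverages.
Context (R : realType) (X : pmetricType R) (X_compact : compact [set: X]).

(** One [e] is at once the length threshold, the slack on the average cost and the gap. If every
    [e = 1 / (k + 1)] fails, the offending chains have lengths tending to infinity and average costs
    at most [1 / (k + 1)]; their limit is a Mather measure with nonnegative integral of [c]. *)
Lemma chain_averages (l0 c : X -> X -> R) (u0 : X -> R) :
  continuous (fun p : X * X => l0 p.1 p.2) ->
  continuous (fun p : X * X => c p.1 p.2) ->
  continuous u0 -> (forall z x, u0 x <= u0 z + l0 z x) ->
  (forall mu : probability (borel (X * X)%type) R, is_mather_measure l0 0 mu ->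
    (\int[mu]_p (c p.1 p.2)%:E < 0)%E) ->
  exists2 e : R, 0 < e & forall (y : nat -> X) n, e^-1 <= n%:R ->
    \sum_(i < n) l0 (y i.+1) (y i) <= e * n%:R ->
    \sum_(i < n) c (y i.+1) (y i) <= - e * n%:R.
Proof.
move=> cl0 cc cu0 u0l Hmu; apply: contrapT => Hneg.
have inv0 k : 0 < k.+1%:R^-1 :> R by rewrite invr_gt0 ltr0n.
have bad k : exists p : (nat -> X) * nat, [/\ k.+1%:R <= p.2%:R :> R,
    \sum_(i < p.2) l0 (p.1 i.+1) (p.1 i) <= k.+1%:R^-1 * p.2%:R &
    - k.+1%:R^-1 * p.2%:R <= \sum_(i < p.2) c (p.1 i.+1) (p.1 i)].
  apply: contrapT => Hk; apply: Hneg; exists k.+1%:R^-1 => // y n.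
  rewrite invrK => kn ln; rewrite leNgt; apply/negP => cn.
  by apply: Hk; exists (y, n); split => //; exact: ltW.
have [YN HYN] := choice bad.
pose Y k := (YN k).1; pose N k := (YN k).2.
have N0 k : 0 < (N k)%:R :> R.
  by have [+ _ _] := HYN k; apply: lt_le_trans; rewrite ltr0n.
pose avg k (f : X * X -> R) := (N k)%:R^-1 * \sum_(i < N k) f (Y k i.+1, Y k i).
have avgD k f g : avg k (fun x => f x + g x) = avg k f + avg k g.
  by rewrite /avg big_split/= mulrDr.
have avgZ k a f : avg k (fun x => a * f x) = a * avg k f.
  by rewrite /avg -mulr_sumr mulrCA.
have avg_le k f g : (forall x, f x <= g x) -> avg k f <= avg k g.
  by move=> fg; rewrite ler_wpM2l ?invr_ge0//; apply: ler_sum => i _.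
have avg1 k a : avg k (fun=> a) = a.
  by rewrite /avg sumr_const card_ord -[a *+ _]mulr_natl mulKf// gt_eqF.
have XX_compact : compact [set: X * X].
  by rewrite -setXTT; exact: compact_setX.
(* An ultrafilter finer than the filter at infinity gives limits of the averages of all continuous
   functions at once. *)
have [U [UU Uoo]] := ultraFilterLemma eventually_filter.
have PU : ProperFilter U by exact: ultra_proper.
pose L f : R := lim (avg k f @[k --> U]).
have Lcvg f : continuous f -> avg k f @[k --> U] --> L f.
  move=> cf; have [M M0 HM] := compact_bounded_fun XX_compact cf.
  have [k|p Hp] := @ultra_bounded_cvg R U (avg^~ f) M UU.
    have HM' x : - M <= f x <= M by rewrite -ler_norml.
    rewrite ler_norml -{1}(avg1 k (- M)) -{2}(avg1 k M).
    by apply/andP; split; apply: avg_le => x; case/andP: (HM' x).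
  by rewrite /L (cvg_lim _ Hp).
have L_pos : normalized_positive (L : (X * X -> R) -> R).
  split=> [f g cf cg|a f cf|f g cf cg fg|].
  - apply: cvg_lim => //; under eq_cvg do rewrite avgD.
    by apply: cvgD; exact: Lcvg.
  - apply: cvg_lim => //; under eq_cvg do rewrite avgZ.
    by apply: cvgMl_tmp; exact: Lcvg.
  - apply: (ler_cvg_to (Lcvg _ cf) (Lcvg _ cg)).
    by apply: filterE => k; exact: avg_le.
  - by apply: cvg_lim => //; under eq_cvg do rewrite avg1; exact: cvg_cst.
have [P PL] := riesz_representation L_pos XX_compact.
have cfst (h : X -> R) : continuous h -> continuous (fun p : X * X => h p.1).
  by move=> ch p; apply: continuous_comp; [exact: cvg_fst|exact: ch].
have csnd (h : X -> R) : continuous h -> continuous (fun p : X * X => h p.2).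
  by move=> ch p; apply: continuous_comp; [exact: cvg_snd|exact: ch].
have inv_cvg : k.+1%:R^-1 @[k --> U] --> (0 : R).
  apply: cvg_trans (@cvg_harmonic R); exact: cvg_fmap2.
(* The two marginals agree in the limit: the difference of the averages telescopes to a bounded
   quantity over [N k]. *)
have Linv h : continuous h -> L (fun p => h p.1) = L (fun p => h p.2).
  move=> ch; have [M M0 HM] := compact_bounded_fun X_compact ch.
  apply/esym/eqP; rewrite -subr_eq0; apply/eqP.
  have H1 : avg k (fun p => h p.2) - avg k (fun p => h p.1) @[k --> U] -->
      L (fun p => h p.2) - L (fun p => h p.1).
    by apply: cvgB; apply: Lcvg; [exact: csnd|exact: cfst].
  have avgE k : avg k (fun p => h p.2) - avg k (fun p => h p.1) =
      (N k)%:R^-1 * (h (Y k 0%N) - h (Y k (N k))).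
    rewrite /avg/= -mulrBr -sumrB; congr (_ * _).
    exact: (telescope_sum_ord (fun i => h (Y k i))).
  rewrite -(cvg_lim (@Rhausdorff R) H1); apply: cvg_lim => //.
  have bnd k : `|(N k)%:R^-1 * (h (Y k 0%N) - h (Y k (N k)))| <=
      2 * M * k.+1%:R^-1.
    rewrite normrM ger0_norm ?invr_ge0// mulrC; apply: ler_pM => //.
    - apply: le_trans (ler_normB _ _) _.
      by have := HM (Y k (N k)); have := HM (Y k 0%N); lra.
    - rewrite lef_pV2 ?posrE//; by have [] := HYN k.
  under eq_cvg do rewrite avgE.
  apply/cvgr0Pnorm_le => e e0.
  have : 2 * M * k.+1%:R^-1 @[k --> U] --> (0 : R).
    rewrite -[X in _ --> X](mulr0 (2 * M)); exact: cvgMl_tmp.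
  move=> /cvgr_le/(_ e e0); apply: filterS => k; exact: le_trans.
(* The upper bound is the slack on the chains; the lower bound integrates the subsolution inequality
   of [u0], whose [u0] terms cancel by [Linv]. *)
have Ll0 : L (fun p => l0 p.1 p.2) = 0.
  apply/eqP; rewrite eq_le; apply/andP; split.
    apply: (ler_cvg_to (Lcvg _ cl0) inv_cvg); apply: filterE => k.
    have [_ + _] := HYN k; rewrite /avg/= ler_pdivrMl// mulrC; exact.
  have : L (fun p => u0 p.2) <= L (fun p => u0 p.1 + l0 p.1 p.2).
    have [_ _ + _] := L_pos; apply => [||x]; [exact: csnd| |exact: u0l].
    by move=> x; apply: cvgD; [exact: cfst|exact: cl0].
  have [LD _ _ _] := L_pos; rewrite LD//; last exact: cfst.
  by rewrite (Linv _ cu0) lerDl.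
have mP : is_mather_measure l0 0 P.
  split; last by rewrite (PL (fun p => l0 p.1 p.2))// Ll0 oppr0.
  apply: borel_pushforward_eq => [||h ch]; first by move=> p; exact: cvg_fst.
    by move=> p; exact: cvg_snd.
  rewrite (PL (fun p => h p.1)) ?(PL (fun p => h p.2)) ?Linv//.
    exact: csnd.
  exact: cfst.
have := Hmu P mP; rewrite (PL (fun p => c p.1 p.2))// lte_fin ltNge.
move=> /negP; apply.
(* The averages of [c] are at least [- 1 / (k + 1)], so their limit cannot be negative. *)
have H0 : - k.+1%:R^-1 @[k --> U] --> (0 : R).
  by rewrite -oppr0; exact: cvgN.
apply: (ler_cvg_to H0 (Lcvg _ cc)); apply: filterE => k.
by have [_ _ +] := HYN k; rewrite /avg/= ler_pdivlMl// mulrC.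
Qed.

End ChainAverages.

(** * The Lax-Oleinik operator *)

Section LaxOleinik.
Context (R : realType) (X : pmetricType R) (X_compact : compact [set: X]).
Context (l : X -> X -> R -> R -> R) (l_cont : continuous (uncurry4 l)).
Context (ku kv : R) (ku_ge0 : 0 <= ku) (kv_ge0 : 0 <= kv).
Context (l_lip : cost_lipschitz l ku kv) (l_dec : cost_nonincreasing l).
Context (lam : R) (lam_gt0 : 0 < lam) (lam_ku : lam * ku <= 1).

Let lip_u z x v a b : `|l z x a v - l z x b v| <= ku * `|a - b|.
Proof. by have [+ _] := l_lip => /(_ z x v (a, b)); apply. Qed.

Let lip_v z x u a b : `|l z x u a - l z x u b| <= kv * `|a - b|.
Proof. by have [_ +] := l_lip => /(_ z x u (a, b)); apply. Qed.

Let dec_u z x v a b : a <= b -> l z x b v <= l z x a v.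
Proof. by have [+ _] := l_dec => /(_ z x v); apply. Qed.

Let dec_v z x u a b : a <= b -> l z x u b <= l z x u a.
Proof. by have [_ +] := l_dec => /(_ z x u); apply. Qed.

Definition implicit_step (phi : X -> R) (z x : X) (t : R) : R :=
  phi z + l z x (lam * phi z) (lam * t).

Let step_dec phi z x s t : s <= t -> implicit_step phi z x t <= implicit_step phi z x s.
Proof. by move=> st; rewrite lerD2l dec_v// ler_pM2l. Qed.

Let step_lip phi z x s t : `|implicit_step phi z x s - implicit_step phi z x t| <= lam * kv * `|s - t|.
Proof.
rewrite /implicit_step opprD addrACA subrr add0r; apply: le_trans (lip_v _ _ _ _ _) _.
by rewrite -mulrBr normrM (gtr0_norm lam_gt0) mulrA [kv * lam]mulrC.
Qed.

(** Since [lam * ku <= 1], the decrease of [l] caused by raising [phi z] is at most the increase of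
    [phi z] itself. *)
Let step_mono (phi psi : X -> R) z x t : phi z <= psi z ->
  implicit_step phi z x t <= implicit_step psi z x t.
Proof.
move=> pp; rewrite /implicit_step.
have := lip_u z x (lam * t) (lam * phi z) (lam * psi z).
rewrite -mulrBr normrM (gtr0_norm lam_gt0) ler_norml => /andP[_ H].
have E : `|phi z - psi z| = psi z - phi z by rewrite distrC ger0_norm// subr_ge0.
rewrite E in H; have : ku * (lam * (psi z - phi z)) <= psi z - phi z.
  by rewrite mulrA [ku * lam]mulrC ler_piMl// subr_ge0.
lra.
Qed.

(* [t = inf_z implicit_step phi z x t]: the implicit equation for [t = T_lam phi x],
   with an infimum so that [phi] may be discontinuous. *)
Definition implicit_inf (phi : X -> R) (x : X) (t : R) : Prop :=
  (forall z, t <= implicit_step phi z x t) /\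
  (forall e, 0 < e -> exists z, implicit_step phi z x t <= t + e).

(** If [t < s], the step at [s] is below the step at [t], which forces [s <= t]. For [phi = psi]
    this is uniqueness of the implicit solution. *)
Lemma implicit_inf_le (phi psi : X -> R) x s t : (forall z, phi z <= psi z) ->
  implicit_inf phi x s -> implicit_inf psi x t -> s <= t.
Proof.
move=> pp [Hs _] [_ Ht]; rewrite leNgt; apply/negP => ts.
suff : s <= t by rewrite leNgt ts.
apply/ler_addgt0Pr => e e0; have [z Hz] := Ht e e0.
apply: le_trans Hz; apply: le_trans (Hs z) _.
by apply: le_trans (step_dec _ _ _ (ltW ts)) (step_mono _ _ (pp z)).
Qed.

Lemma cvg_uncurry4 (T : Type) (F : set_system T) (FF : Filter F)
    (f g : T -> X) (a b : T -> R) (z x : X) (u v : R) :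
  f @ F --> z -> g @ F --> x -> a @ F --> u -> b @ F --> v ->
  l (f t) (g t) (a t) (b t) @[t --> F] --> l z x u v.
Proof.
move=> fz gx au bv.
have H : (f t, g t, a t, b t) @[t --> F] --> (z, x, u, v).
  exact: cvg_pair (cvg_pair (cvg_pair fz gx) au) bv.
have H' : uncurry4 l p @[p --> (z, x, u, v)] --> uncurry4 l (z, x, u, v).
  exact: l_cont.
exact: cvg_comp H H'.
Qed.

Let l0_continuous : continuous (fun p : X * X => l p.1 p.2 0 0).
Proof.
move=> p; apply: cvg_uncurry4; [exact: cvg_fst|exact: cvg_snd| |];
  exact: cvg_cst.
Qed.

Let l0_bounded : exists2 B, 0 < B & forall z x, `|l z x 0 0| <= B.
Proof.
have XX : compact [set: X * X] by rewrite -setXTT; exact: compact_setX.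
have [B B0 HB] := compact_bounded_fun XX l0_continuous.
by exists B => // z x; exact: (HB (z, x)).
Qed.

(** The solution is the supremum of all [t] lying below every [implicit_step phi z x t]. The bound
    [M'] adds [M] for [phi z], [B] for [l] at [(0, 0)] and [M] for moving its first argument, as
    [lam * ku <= 1]. *)
Lemma implicit_inf_exists (M : R) : 0 <= M -> exists2 M', M <= M' &
  forall phi, (forall z, `|phi z| <= M) ->
  forall x, exists2 t, `|t| <= M' & implicit_inf phi x t.
Proof.
move=> M0; have [B B0 HB] := l0_bounded.
have HB' phi (z x : X) : `|phi z| <= M -> `|implicit_step phi z x 0| <= M + (B + M).
  move=> phiM; apply: le_trans (ler_normD _ _) _; apply: lerD => //.
  have := lip_u z x (lam * 0) (lam * phi z) 0.
  rewrite subr0 mulr0 normrM (gtr0_norm lam_gt0) => H.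
  rewrite -[l _ _ _ _](subrK (l z x 0 0)) addrC.
  apply: le_trans (ler_normD _ _) _; apply: lerD => //.
  apply: le_trans H _; rewrite mulrA; apply: le_trans phiM.
  by rewrite ler_piMl// mulrC.
exists (M + (B + M)) => [|phi phiM x].
  by rewrite lerDl addr_ge0// ltW.
set M' := M + (B + M).
have M'0 : 0 <= M' by rewrite !addr_ge0// ltW.
pose S : set R := [set t | forall z, t <= implicit_step phi z x t].
have Sub t : S t -> t <= M'.
  move=> St; have [t0|/ltW t0] := leP t 0; first exact: le_trans M'0.
  apply: le_trans (St point) _; apply: le_trans (step_dec _ _ _ t0) _.
  by have := HB' phi point x (phiM _); rewrite ler_norml => /andP[].
have SM : S (- M').
  move=> z; apply: (@le_trans _ _ (implicit_step phi z x 0)).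
    by have := HB' phi z x (phiM _); rewrite ler_norml => /andP[].
  by apply: step_dec; rewrite oppr_le0.
have hsS : has_sup S by split; [exists (- M')|exists M'].
pose t := sup S.
(* The map [t |-> t - implicit_step phi z x t] is Lipschitz with this constant, so a move of [t] by
   [e / (1 + lam * kv)] changes it by at most [e]. *)
have kv1 : 0 < 1 + lam * kv by rewrite ltr_pwDl// mulr_ge0// ltW.
have St : S t.
  move=> z; apply/ler_addgt0Pr => e e0.
  have d0 : 0 < e / (1 + lam * kv) by rewrite divr_gt0.
  have [s Ss] := sup_adherent d0 hsS; rewrite -/t => ts.
  have st : s <= t by exact: (sup_upper_bound hsS).
  have := Ss z; have := step_lip phi z x s t.
  rewrite ler_norml => /andP[_]; rewrite distrC ger0_norm ?subr_ge0// => H1 H2.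
  have : (1 + lam * kv) * (t - s) <= e.
    by rewrite mulrC -ler_pdivlMr//; lra.
  lra.
exists t.
  rewrite ler_norml; apply/andP; split; last exact: Sub.
  exact: (sup_upper_bound hsS).
split => // e e0; apply: contrapT => Hno.
have d0 : 0 < e / (1 + lam * kv) by rewrite divr_gt0.
set d := e / _ in d0.
have dE : d + lam * kv * d = e.
  by rewrite /d -[X in X + _]mul1r -mulrDl mulrC divfK// gt_eqF.
suff : t + d <= t by rewrite gerDl leNgt d0.
apply: (sup_upper_bound hsS) => /=.
move=> z; have : t + e < implicit_step phi z x t.
  by rewrite ltNge; apply/negP => H; apply: Hno; exists z.
have := step_lip phi z x (t + d) t.
rewrite ler_norml => /andP[+ _]; rewrite [t + d]addrC addrK gtr0_norm//.
lra.
Qed.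

(** Tube lemma over a compact set of [(z, a, b)]. *)
Let uniform_in_x (M e : R) (x : X) : 0 < e -> \forall y \near x,
  forall z a b, `|a| <= M -> `|b| <= M -> `|l z y a b - l z x a b| <= e.
Proof.
move=> e0; pose K : set (X * R * R) := [set: X] `*` `[- M, M] `*` `[- M, M].
have cK : compact K.
  by apply: compact_setX; [apply: compact_setX => //|]; exact: segment_compact.
pose P (y : X) (q : X * R * R) :=
  `|l q.1.1 y q.1.2 q.2 - l q.1.1 x q.1.2 q.2| <= e.
suff : \near x, K `<=` P x.
  apply: filterS => y KP z a b aM bM; apply: (KP (z, a, b)).
  by split; [split|]; rewrite //= in_itv/= -ler_norml.
apply: (compact_near_coveringP K).1 => // q _.
pose F (r : X * R * R * X) := l r.1.1.1 r.2 r.1.1.2 r.1.2.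
have cF : {for (q, x), continuous F}.
  have c1 : r.1 @[r --> (q, x)] --> q by exact: cvg_fst.
  have c11 : r.1.1 @[r --> (q, x)] --> q.1 by apply: cvg_comp c1 _; exact: cvg_fst.
  have c111 : r.1.1.1 @[r --> (q, x)] --> q.1.1 by apply: cvg_comp c11 _; exact: cvg_fst.
  have c112 : r.1.1.2 @[r --> (q, x)] --> q.1.2 by apply: cvg_comp c11 _; exact: cvg_snd.
  have c12 : r.1.2 @[r --> (q, x)] --> q.2 by apply: cvg_comp c1 _; exact: cvg_snd.
  have c2 : r.2 @[r --> (q, x)] --> x by exact: cvg_snd.
  exact: cvg_uncurry4.
have e2 : 0 < e / 2 by rewrite divr_gt0.
have [[V W] /= [Vq Wx] VW] : \forall r \near (q, x), `|F (q, x) - F r| <= e / 2.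
  by move/cvgrPdist_le : cF => /(_ _ e2).
exists (V, W) => //= -[q' y] /= [Vq' Wy].
have H1 := VW (q', y) (conj Vq' Wy).
have H2 := VW (q', x) (conj Vq' (nbhs_singleton Wx)).
rewrite /P; apply: le_trans (_ : `|F (q', y) - F (q, x)| + `|F (q, x) - F (q', x)| <= _).
  exact: ler_distD.
by rewrite distrC in H1; move: H1 H2 => /=; lra.
Qed.

(** If [psi y > psi y'], monotonicity in [t] allows [psi y] to be replaced by [psi y'] inside [l];
    only the variation of [l] in its second argument remains, uniformly small. A bounded [phi] is
    thereby regularized. *)
Lemma implicit_inf_continuous (phi psi : X -> R) (M : R) :
  (forall z, `|phi z| <= M) -> (forall z, `|psi z| <= M) ->
  (forall x, implicit_inf phi x (psi x)) -> continuous psi.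
Proof.
move=> phiM psiM H x; apply/cvgrPdist_le => e e0.
have e2 : 0 < e / 2 by rewrite divr_gt0.
have key (y y' : X) : (forall z a b, `|a| <= lam * M -> `|b| <= lam * M ->
    `|l z y a b - l z y' a b| <= e / 2) -> psi y <= psi y' + e.
  move=> Hyy; have [H0|/ltW H0] := leP (psi y) (psi y').
    by apply: le_trans H0 _; rewrite lerDl ltW.
  have [z Hz] := (H y').2 _ e2; have := (H y).1 z.
  have := step_dec phi z y H0.
  have M1 (f : X -> R) w : `|f w| <= M -> `|lam * f w| <= lam * M.
    by move=> fM; rewrite normrM gtr0_norm// ler_pM2l.
  have := Hyy z _ _ (M1 phi z (phiM z)) (M1 psi y' (psiM y')).
  rewrite ler_norml => /andP[_]; move: Hz; rewrite /implicit_step; lra.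
have := @uniform_in_x (lam * M) _ x e2.
apply: filterS => y Hy; rewrite ler_distl.
apply/andP; split; last first.
  by apply: key => z a b aM bM; rewrite distrC; exact: Hy.
by rewrite lerBlDr; apply: key.
Qed.

Lemma implicit_step_continuous (phi : X -> R) (x : X) (t : R) : continuous phi ->
  continuous (fun z => implicit_step phi z x t).
Proof.
move=> cphi z; apply: cvgD; first exact: cphi.
apply: cvg_uncurry4; [exact: cvg_id|exact: cvg_cst| |exact: cvg_cst].
by apply: cvgMl_tmp; exact: cphi.
Qed.

Lemma implicit_infP (phi : X -> R) (x : X) (t : R) : continuous phi ->
  implicit_inf phi x t <-> is_min (range (fun z => implicit_step phi z x t)) t.
Proof.
move=> cphi; split=> [[Hl Hi]|[[z _ Hz] Hl]]; last first.
  split=> [z'|e e0]; first by apply: Hl; exists z'.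
  by exists z; rewrite Hz lerDl ltW.
split; last by move=> _ [z _ <-].
have [||z _ Hz] := @compact_EVT_min _ _ (fun z => implicit_step phi z x t) [set: X] _ X_compact.
  by exists point.
  by apply: continuous_subspaceT; exact: implicit_step_continuous.
exists z => //; apply/eqP; rewrite eq_le Hl andbT.
apply/ler_addgt0Pr => e e0; have [z' Hz'] := Hi e e0.
by apply: le_trans Hz'; apply: Hz; rewrite inE.
Qed.

(** From left to right, solvability of the implicit equation excludes the default value of [xget];
    from right to left, uniqueness identifies the selected solution with [u]. *)
Lemma lax_oleinik_fixedP (u : X -> R) : continuous u ->
  lax_oleinik l lam u = u <->
  forall x, is_min (range (fun z => u z + l z x (lam * u z) (lam * u x))) (u x).
Proof.
move=> cu; pose S : set (X -> R) := [set psi | continuous psi /\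
  forall x, is_min (range (fun z => implicit_step u z x (psi x))) (psi x)].
have [M M0 HM] := compact_bounded_fun X_compact cu.
have lax_in psi : S psi -> S (lax_oleinik l lam u).
  by move=> Spsi; exact: (xgetPex (fun=> 0) (ex_intro _ psi Spsi)).
split=> [uE|Hu].
  suff [psi Spsi] : exists psi, S psi by have [_] := lax_in _ Spsi; rewrite uE.
  have [M' MM' HM'] := implicit_inf_exists (ltW M0).
  have /choice[psi Hpsi] : forall x, exists t, `|t| <= M' /\ implicit_inf u x t.
    by move=> x; have [t ? ?] := HM' u HM x; exists t.
  exists psi; split.
    apply: (@implicit_inf_continuous u psi M') => [z|z|x].
    - exact: le_trans (HM z) MM'.
    - by have [] := Hpsi z.
    - by have [] := Hpsi x.
  by move=> x; apply/implicit_infP => //; have [] := Hpsi x.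
have [_ HL] := lax_in u (conj cu Hu).
apply/funext => x; have /implicit_infP-/(_ cu) H1 := HL x.
have /implicit_infP-/(_ cu) H2 := Hu x.
by apply/eqP; rewrite eq_le !(implicit_inf_le _ H1 H2, implicit_inf_le _ H2 H1).
Qed.

Lemma exists_fixed_point (u0 : X -> R) : continuous u0 ->
  (forall x, is_min (range (fun z => u0 z + l z x 0 0)) (u0 x)) ->
  exists u, continuous u /\ lax_oleinik l lam u = u.
Proof.
move=> cu0 Hu0; have [C C0 HC] := compact_bounded_fun X_compact cu0.
have [M' MM' HM'] := implicit_inf_exists (addr_ge0 (ltW C0) (ltW C0)).
(* The shifts by [C] fix the signs: nonpositive arguments raise [l] above its value at [(0, 0)],
   nonnegative ones lower it, which yields [umE] and [upE]. *)
pose um x := u0 x - C; pose up x := u0 x + C.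
have um0 x : um x <= 0 by have := HC x; rewrite ler_norml /um; lra.
have up0 x : 0 <= up x by have := HC x; rewrite ler_norml /up; lra.
have bnd w : (forall x, um x <= w x <= up x) -> forall x, `|w x| <= C + C.
  move=> Hw x; have := HC x; have := Hw x.
  rewrite !ler_norml /um /up => /andP[? ?] /andP[? ?]; apply/andP; split; lra.
have umE x t : implicit_inf um x t -> um x <= t.
  move=> [_ Ht]; rewrite leNgt; apply/negP => tu.
  suff : um x <= t by rewrite leNgt tu.
  apply/ler_addgt0Pr => e e0; have [z Hz] := Ht e e0.
  apply: le_trans Hz; have [_ /(_ (u0 z + l z x 0 0))] := Hu0 x.
  have lamt : lam * t <= 0 by rewrite pmulr_rle0// ltW// (lt_le_trans tu).
  have lamz : lam * um z <= 0 by rewrite pmulr_rle0.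
  have := dec_u z x (lam * t) lamz; have := dec_v z x 0 lamt.
  by rewrite /implicit_step/= => ? ? /(_ (ex_intro2 _ _ z I erefl)); rewrite /um in tu *; lra.
have upE x t : implicit_inf up x t -> t <= up x.
  move=> [Ht _]; rewrite leNgt; apply/negP => tu.
  suff : t <= up x by rewrite leNgt tu.
  have [[z _ Hz] _] := Hu0 x; apply: le_trans (Ht z) _.
  have lamt : 0 <= lam * t by rewrite pmulr_rge0// ltW// (le_lt_trans _ tu).
  have lamz : 0 <= lam * up z by rewrite pmulr_rge0.
  have := dec_u z x (lam * t) lamz; have := dec_v z x 0 lamt.
  by rewrite /implicit_step/= /up -Hz => ? ?; lra.
(* Subsolutions between [um] and [up]. Their pointwise supremum [u] may be discontinuous a priori;
   its image [v] satisfies [u <= v] and lies in [S], hence [v = u], and continuity follows from the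
   equation. *)
pose S : set (X -> R) := [set w | (forall x, um x <= w x <= up x) /\
  forall x t, implicit_inf w x t -> w x <= t].
have Sum : S um.
  by split=> [x|//]; rewrite lexx /um /up; lra.
pose u x := sup [set w x | w in S].
have hsS x : has_sup [set w x | w in S].
  split; first by exists (um x); exists um.
  by exists (up x) => _ [w [Hw _] <-]; case/andP: (Hw x).
have u_ge w x : S w -> w x <= u x.
  by move=> Sw; apply: (sup_upper_bound (hsS x)); exists w.
have u_le b x : (forall w, S w -> w x <= b) -> u x <= b.
  move=> H; apply: ge_sup; first by case: (hsS x).
  by move=> _ [w Sw <-]; exact: H.
have Hu x : um x <= u x <= up x.
  by rewrite u_ge//=; apply: u_le => w [Hw _]; case/andP: (Hw x).
have u_sub x t : implicit_inf u x t -> u x <= t.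
  move=> Ht; apply: u_le => w Sw; have [Hw wsub] := Sw.
  have [s _ Hs] := HM' w (bnd w Hw) x.
  by apply: le_trans (wsub x s Hs) (implicit_inf_le _ Hs Ht) => z; exact: u_ge.
have /choice[v Hv] : forall x, exists t, implicit_inf u x t.
  by move=> x; have [t _ ?] := HM' u (bnd u Hu) x; exists t.
have uv x : u x <= v x by exact: u_sub.
have Sv : S v.
  split=> [x|x t Ht]; last exact: implicit_inf_le (Hv x) Ht.
  have Hup y : um y <= up y <= up y by rewrite lexx andbT /um /up; lra.
  have [s _ Hs] := HM' up (bnd up Hup) x.
  have /andP[um_u _] := Hu x; rewrite (le_trans um_u)//=.
  apply: le_trans (upE x s Hs); apply: implicit_inf_le (Hv x) Hs => z.
  by case/andP: (Hu z).
have vu : v = u.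
  by apply/funext => x; apply/eqP; rewrite eq_le uv andbT u_ge.
have uu x : implicit_inf u x (u x) by rewrite -{2}vu.
have cu : continuous u.
  by apply: (@implicit_inf_continuous u u (C + C)) => //; exact: bnd.
exists u; split => //; apply/lax_oleinik_fixedP => // x.
by apply/implicit_infP.
Qed.

End LaxOleinik.

(** * Secants near the origin *)

(** The three-slope inequality with denominators cleared; [t] is the weight of [x] in [y] as a
    convex combination of [x] and [z]. *)
Lemma concave_slope_le (R : realType) (f : R -> R) (x y z : R) :
  concave_function f -> x < y -> y < z ->
  (f z - f y) * (y - x) <= (f y - f x) * (z - y).
Proof.
move=> fc xy yz; pose t := (z - y) / (z - x).
have zx : 0 < z - x by rewrite subr_gt0 (lt_trans xy).
have t01 : 0 <= t <= 1.
  by rewrite divr_ge0 ?ler_pdivrMr// ?mul1r; lra.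
have := fc (@Itv01 R t (andP t01).1 (andP t01).2) x z (in_setT _) (in_setT _).
set p := Itv01 _ _; rewrite (convRE _ _ p).
have -> : conv p (x : convex_lmodType R^o) (z : convex_lmodType R^o) = y.
  transitivity (t * x + (1 - t) * z); first exact: (convRE x z p).
  by rewrite /t; field; rewrite gt_eqF.
rewrite /= /unstable.onem.
have tE : t * (z - x) = z - y by rewrite /t divfK// gt_eqF.
move=> /(ler_wpM2r (ltW zx)).
have -> : (t * - f x + (1 - t) * - f z) * (z - x) =
  - f x * (t * (z - x)) - f z * ((z - x) - t * (z - x)) by ring.
by rewrite tE; lra.
Qed.

Lemma modulus_small (R : realType) (eta : R -> R) (e : R) :
  modulus_of_continuity eta -> 0 < e ->
  exists2 r, 0 < r & forall s, 0 <= s <= r -> 0 <= eta s <= e.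
Proof.
move=> [nd eta0 ceta] e0.
have /cvgrPdist_le/(_ _ e0) H := ceta.
have [r [r0 Hr]] : exists r, 0 < r /\ `|eta 0 - eta r| <= e.
  have [r [? ?]] := filter_ex (filterI (nbhs_right_gt (0 : R)) H).
  by exists r.
exists r => // s /andP[s0 sr]; rewrite -{1}eta0.
have in0 a : 0 <= a -> a \in `[0, +oo[ by move=> ?; rewrite in_itv/= andbT.
rewrite nd ?in0//=; apply: le_trans (nd s r _ _ sr) _; rewrite ?in0//.
  exact: ltW.
by move: Hr; rewrite eta0 sub0r normrN => /ler_normlW.
Qed.

Lemma exists_large_nat (R : realType) (A B d : R) : 0 < d ->
  exists n : nat, A <= n%:R /\ B < d * n%:R.
Proof.
move=> d0; exists (Num.bound (`|A| + `|B| / d)).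
have H : `|A| + `|B| / d < (Num.bound (`|A| + `|B| / d))%:R.
  by apply: archi_boundP; rewrite addr_ge0// divr_ge0// ltW.
have Bd : 0 <= `|B| / d by rewrite divr_ge0// ltW.
split; first by have := ler_norm A; lra.
rewrite mulrC -ltr_pdivrMr//; apply: le_lt_trans H.
have : B / d <= `|B| / d by rewrite ler_pM2r ?invr_gt0// ler_norm.
by have := normr_ge0 A; lra.
Qed.

Section Secants.
Context (R : realType) (X : pmetricType R) (X_compact : compact [set: X]).
Context (l : X -> X -> R -> R -> R) (l_cont : continuous (uncurry4 l)).
Context (eta : R -> R) (eta_mod : modulus_of_continuity eta).
Context (l_exp : cost_expansion l eta).

(** By [diagonal_expansion], the derivative of [s |-> l z x s s] at 0. *)
Definition cost_derivative (z x : X) : R :=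
  partial_u l z x 0 0 + partial_v l z x 0 0.

Lemma diagonal_expansion z x s :
  `|l z x s s - l z x 0 0 - cost_derivative z x * s| <= `|s| * eta `|s|.
Proof.
have [_ /(_ z x s s)] := l_exp.
have -> : (`|s| + `|s|) / 2 = `|s| by lra.
by rewrite /cost_derivative mulrDl opprD addrA.
Qed.

(** A uniform limit of continuous functions: the quotient [(l z x s s - l z x 0 0) / s] is within
    [eta s] of the derivative for all [(z, x)]. Everything is multiplied by [s], with three errors
    of size [s * e / 4]. *)
Lemma cost_derivative_continuous :
  continuous (fun p : X * X => cost_derivative p.1 p.2).
Proof.
move=> p; apply/cvgrPdist_le => e e0.
have e4 : 0 < e / 4 by rewrite divr_gt0.
have [s s0 Hs] := modulus_small eta_mod e4.
have /andP[eta0 etae] : 0 <= eta s <= e / 4 by apply: Hs; rewrite lexx ltW.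
pose g (q : X * X) := l q.1 q.2 s s - l q.1 q.2 0 0.
have cg : g q @[q --> p] --> g p.
  by apply: cvgB; (apply: (cvg_uncurry4 l_cont);
    [exact: cvg_fst|exact: cvg_snd|exact: cvg_cst|exact: cvg_cst]).
have es : 0 < s * e / 4 by rewrite divr_gt0// mulr_gt0.
move/cvgrPdist_le : cg => /(_ _ es); apply: filterS => q.
have := @diagonal_expansion p.1 p.2 s.
have := @diagonal_expansion q.1 q.2 s.
rewrite (gtr0_norm s0) -/(g p) -/(g q).
have se : s * eta s <= s * e / 4 by rewrite -mulrA ler_pM2l.
set cp := cost_derivative p.1 p.2; set cq := cost_derivative q.1 q.2.
move=> Hq Hp Hg; rewrite -(ler_pM2l s0) -{1}(gtr0_norm s0) -normrM.
move: Hq Hp Hg; rewrite !ler_norml => /andP[? ?] /andP[? ?] /andP[? ?].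
by apply/andP; split; lra.
Qed.

(* The secants of [l] near [(0,0)] are, from above, no steeper than the
   partial derivatives at [(0,0)]: this is the only consequence of concavity,
   or of continuous differentiability, that uniqueness requires. *)
Definition secants_le : Prop := forall e, 0 < e -> exists2 r, 0 < r &
  forall z x a a' w, `|a| <= r -> `|a'| <= r -> `|w| <= r -> a <= a' ->
    l z x a' w - l z x a w <= (partial_u l z x 0 0 + e) * (a' - a) /\
    l z x w a' - l z x w a <= (partial_v l z x 0 0 + e) * (a' - a).

(** The expansion (l3) controls only secants whose length is comparable to their distance from 0,
    such as the one over [[- 2 * h, - h]]; by concavity this one bounds the slope of every secant to
    its right. *)
Lemma concave_secants_le : cost_concave l -> secants_le.
Proof.
move=> [conc_u conc_v] e e0.
have e4 : 0 < e / 4 by rewrite divr_gt0.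
have [s s0 Hs] := modulus_small eta_mod e4.
(* Then [(2 * h + h / 2) / 2 <= s], so [eta] is at most [e / 4] where it is evaluated, and the
   errors at [- h] and [- (2 * h)] add up to at most [h * e]. *)
pose h := s / 2; have h0 : 0 < h by rewrite divr_gt0.
have key (f : R -> R) (D a a' : R) : concave_function f ->
    f (- h) - f (- (2 * h)) <= (D + e) * h ->
    - (h / 2) <= a -> a <= a' -> f a' - f a <= (D + e) * (a' - a).
  move=> fc H Ha; rewrite le_eqVlt => /orP[/eqP ->|aa'].
    by rewrite !subrr mulr0.
  have h1 : - (2 * h) < - h by lra.
  have h2 : - h < a by lra.
  have S1 := concave_slope_le fc h1 h2.
  have S2 := concave_slope_le fc h2 aa'.
  have ah : 0 < a + h by lra.
  have S1' : (f a - f (- h)) <= (D + e) * (a + h).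
    rewrite -(ler_pM2r h0).
    have -> : (D + e) * (a + h) * h = (D + e) * h * (a + h) by ring.
    have : (f (- h) - f (- (2 * h))) * (a + h) <= (D + e) * h * (a + h).
      by rewrite ler_pM2r.
    have E1 : - h - - (2 * h) = h by lra.
    have E2 : a - - h = a + h by lra.
    by move: S1; rewrite E1 E2 => *; lra.
  rewrite -(ler_pM2r ah).
  have -> : (D + e) * (a' - a) * (a + h) = (D + e) * (a + h) * (a' - a) by ring.
  have : (f a - f (- h)) * (a' - a) <= (D + e) * (a + h) * (a' - a).
    by rewrite ler_pM2r ?subr_gt0.
  have E2 : a - - h = a + h by lra.
  by move: S2; rewrite E2 => *; lra.
have eta_h (b w : R) : 0 < b -> b <= 2 * h -> `|w| <= h / 2 ->
    (`|- b| + `|w|) / 2 * eta ((`|- b| + `|w|) / 2) <= (b + h / 2) / 2 * (e / 4).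
  move=> b0 bh wh; rewrite normrN (gtr0_norm b0).
  have w0 := normr_ge0 w.
  have /andP[? ?] : 0 <= eta ((b + `|w|) / 2) <= e / 4.
    by apply: Hs; apply/andP; split; rewrite /h in bh wh *; lra.
  by apply: ler_pM => //; lra.
have h2 : 0 < h / 2 by rewrite divr_gt0.
have b1 : 0 < h by [].
have b2 : 0 < 2 * h by rewrite mulr_gt0.
have hh : h <= 2 * h by lra.
have he : 0 < h * e by rewrite mulr_gt0.
exists (h / 2) => // z x a a' w ar a'r wr aa'.
have Ha : - (h / 2) <= a by move: ar; rewrite ler_norml => /andP[].
have [_ E] := l_exp; split.
- apply: (key (fun b => l z x b w)) => //.
  have := E z x (- h) w; have := E z x (- (2 * h)) w.
  have := eta_h _ w b1 hh wr; have := eta_h _ w b2 (lexx _) wr.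
  move=> B2 B1 /le_trans/(_ B2) + /le_trans/(_ B1).
  by rewrite !ler_norml => /andP[? ?] /andP[? ?]; lra.
- apply: (key (fun b => l z x w b)) => //.
  have := E z x w (- h); have := E z x w (- (2 * h)).
  have := eta_h _ w b1 hh wr; have := eta_h _ w b2 (lexx _) wr.
  rewrite ![`|- _| + _]addrC.
  move=> B2 B1 /le_trans/(_ B2) + /le_trans/(_ B1).
  by rewrite !ler_norml => /andP[? ?] /andP[? ?]; lra.
Qed.

(** Tube lemma: the estimate holds near each [(z, x, 0, 0)], hence with one [r] for all [(z, x)] by
    compactness. *)
Lemma near0_uniform (f : X -> X -> R -> R -> R) (d e : R) : 0 < d -> 0 < e ->
  {within [set p : X * X * R * R | `|p.1.2| < d /\ `|p.2| < d],
    continuous (uncurry4 f)} ->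
  exists2 r, 0 < r < d & forall z x a b, `|a| <= r -> `|b| <= r ->
    `|f z x a b - f z x 0 0| <= e.
Proof.
move=> d0 e0; set A := [set p : X * X * R * R | _].
have oA : open A.
  have onorm (g : X * X * R * R -> R) : continuous g ->
      open [set p | `|g p| < d].
    move=> cg; apply: (@open_comp _ _ (fun p => `|g p|) [set y | y < d]).
      by move=> p _; apply: cvg_norm; exact: cg.
    exact: open_lt.
  apply: openI; apply: onorm => p; last exact: cvg_snd.
  by apply: cvg_comp; [exact: cvg_fst|exact: cvg_snd].
rewrite continuous_open_subspace// => cf.
have XX : compact [set: X * X] by rewrite -setXTT; exact: compact_setX.
pose P (ab : R * R) (q : X * X) :=
  `|f q.1 q.2 ab.1 ab.2 - f q.1 q.2 0 0| <= e.
have : \forall ab \near (0 : R, 0 : R), [set: X * X] `<=` P ab.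
  refine ((compact_near_coveringP _).1 XX (R * R)%type (nbhs (0 : R, 0 : R))
    P _ _) => q _.
  have cq : {for (q, 0, 0), continuous (uncurry4 f)}.
    by apply: cf; rewrite inE /A/= normr0.
  pose h (r : X * X * (R * R)) := f r.1.1 r.1.2 r.2.1 r.2.2.
  have ch : h r @[r --> (q, (0, 0))] --> h (q, (0, 0)).
    have c1 : r.1 @[r --> (q, (0 : R, 0 : R))] --> q by exact: cvg_fst.
    have c2 : r.2 @[r --> (q, (0 : R, 0 : R))] --> (0 : R, 0 : R) by exact: cvg_snd.
    have c21 : r.2.1 @[r --> (q, (0 : R, 0 : R))] --> (0 : R).
      by apply: cvg_comp c2 _; exact: cvg_fst.
    have c22 : r.2.2 @[r --> (q, (0 : R, 0 : R))] --> (0 : R).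
      by apply: cvg_comp c2 _; exact: cvg_snd.
    have H : (r.1, r.2.1, r.2.2) @[r --> (q, (0 : R, 0 : R))] -->
        (q, 0 : R, 0 : R).
      exact: cvg_pair (cvg_pair c1 c21) c22.
    have H' : uncurry4 f p @[p --> (q, 0, 0)] --> uncurry4 f (q, 0, 0) by exact: cq.
    exact: cvg_comp H H'.
  have e2 : 0 < e / 2 by rewrite divr_gt0.
  have [[V W] /= [Vq W0] VW] :
      \forall r \near (q, (0 : R, 0 : R)), `|h (q, (0, 0)) - h r| <= e / 2.
    by move/cvgrPdist_le : ch => /(_ _ e2).
  exists (V, W) => //= -[q' ab] /= [Vq' Wab].
  have H1 := VW (q', ab) (conj Vq' Wab).
  have H2 := VW (q', (0, 0)) (conj Vq' (nbhs_singleton W0)).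
  rewrite /P; apply: le_trans (_ : `|h (q', ab) - h (q, (0, 0))| +
    `|h (q, (0, 0)) - h (q', (0, 0))| <= _); first exact: ler_distD.
  by rewrite distrC in H1; move: H1 H2 => /=; lra.
move=> /nbhs_ballP[s /= s0 sP].
exists (Num.min s d / 2).
  by rewrite divr_gt0 ?lt_min ?s0//= ltr_pdivrMr// gt_min; apply/orP; right; lra.
have rs : Num.min s d / 2 < s.
  by rewrite ltr_pdivrMr// gt_min; apply/orP; left; lra.
move=> z x a b ar br; apply: (sP (a, b) _ (z, x)) => //.
by split; rewrite /ball/= sub0r normrN; exact: le_lt_trans rs.
Qed.

(** Mean value theorem, with derivatives uniformly close to those at [(0, 0)]. *)
Lemma C1_secants_le : cost_C1_near0 l -> secants_le.
Proof.
move=> [d d0 [Hder cu cv]] e e0.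
have [r1 /andP[r10 r1d] H1] := near0_uniform d0 e0 cu.
have [r2 /andP[r20 r2d] H2] := near0_uniform d0 e0 cv.
have key (f : R -> R) (D a a' r : R) : r < d ->
    (forall b, `|b| < d -> derivable f b 1) ->
    (forall b, `|b| <= r -> `|derive1 f b - D| <= e) ->
    `|a| <= r -> `|a'| <= r -> a <= a' -> f a' - f a <= (D + e) * (a' - a).
  move=> rd df Hf ar a'r aa'.
  have inr b : b \in `[a, a'] -> `|b| <= r.
    move: ar a'r; rewrite in_itv/= !ler_norml => /andP[? ?] /andP[? ?] /andP[? ?].
    by apply/andP; split; lra.
  have [||c cin ->] := @MVT_segment R f (derive1 f) a a' aa'.
  - move=> b bin; rewrite derive1E; apply/derivableP/df.
    by apply: le_lt_trans rd; apply: inr; exact: subset_itv_oo_cc.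
  - apply: derivable_within_continuous => b bin; apply: df.
    by apply: le_lt_trans rd; exact: inr.
  rewrite ler_wpM2r ?subr_ge0//.
  by have := Hf c (inr c cin); rewrite ler_norml; lra.
exists (Num.min r1 r2) => [|z x a a' w]; first by rewrite lt_min r10.
rewrite !le_min => /andP[ar1 ar2] /andP[a'r1 a'r2] /andP[wr1 wr2] aa'; split.
- apply: (key (fun b => l z x b w) _ _ _ r1) => // b bd.
    have [H _] := Hder z x b w bd (le_lt_trans wr1 r1d); exact: H.
  exact: H1.
- apply: (key (fun b => l z x w b) _ _ _ r2) => // b bd.
    have [_ H] := Hder z x w b (le_lt_trans wr2 r2d) bd; exact: H.
  exact: H2.
Qed.

End Secants.

(** * Bounds and comparison of fixed points *)

Lemma sum_ord_cst (R : realType) (n : nat) (a : R) :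
  \sum_(i < n) a = a * n%:R.
Proof. by rewrite sumr_const card_ord mulr_natr. Qed.

Section FixedPoints.
Context (R : realType) (X : pmetricType R) (X_compact : compact [set: X]).
Context (l : X -> X -> R -> R -> R) (l_cont : continuous (uncurry4 l)).
Context (ku kv : R) (ku_ge0 : 0 <= ku) (kv_ge0 : 0 <= kv).
Context (l_lip : cost_lipschitz l ku kv) (l_dec : cost_nonincreasing l).
Context (eta : R -> R) (eta_mod : modulus_of_continuity eta).
Context (l_exp : cost_expansion l eta).
Context (u0 : X -> R) (u0_cont : continuous u0)
  (u0_kam : forall x, is_min (range (fun z => u0 z + l z x 0 0)) (u0 x)).
Context (e0 : R) (e0_gt0 : 0 < e0)
  (chain_e0 : forall (y : nat -> X) n, e0^-1 <= n%:R ->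
    \sum_(i < n) l (y i.+1) (y i) 0 0 <= e0 * n%:R ->
    \sum_(i < n) cost_derivative l (y i.+1) (y i) <= - e0 * n%:R).

Let dec_uv z x a b a' b' : a <= a' -> b <= b' -> l z x a' b' <= l z x a b.
Proof.
move=> aa' bb'; have [du dv] := l_dec.
exact: le_trans (du z x b' _ _ aa') (dv z x a _ _ bb').
Qed.

Let lip_uv z x a b c : `|a| <= c -> `|b| <= c ->
  `|l z x a b - l z x 0 0| <= (ku + kv) * c.
Proof.
move=> ac bc; have [/(_ z x b (a, 0) (conj I I)) H1 /(_ z x 0 (b, 0) (conj I I)) H2] := l_lip.
move: H1 H2; rewrite /= !subr0 => H1 H2.
apply: le_trans (ler_distD (l z x 0 b) _ _) _; rewrite mulrDl; apply: lerD.
  by apply: le_trans H1 _; rewrite ler_wpM2l.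
by apply: le_trans H2 _; rewrite ler_wpM2l.
Qed.

Definition discounted_solution (lam : R) (u : X -> R) : Prop :=
  continuous u /\
  forall x, is_min (range (fun z => u z + l z x (lam * u z) (lam * u x))) (u x).

Let calibrated (u : X -> R) (f : X -> X -> R) (x : X) :
  (forall x, is_min (range (fun z => u z + f z x)) (u x)) ->
  exists y : nat -> X, y 0%N = x /\
    forall i, u (y i) = u (y i.+1) + f (y i.+1) (y i).
Proof.
move=> Hu; have /choice[s Hs] : forall x, exists z, u z + f z x = u x.
  by move=> x'; have [[z _ Hz] _] := Hu x'; exists z.
by exists (fun i => iter i s x); split => // i; rewrite /= Hs.
Qed.

(** Along the chain of [u], [l] is at least its value at [(- lam, - lam)], so the cost exceeds that
    of [l] at [(0, 0)] by at least [lam * (e0 / 2)] per step on average. The latter sum is bounded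
    below through [u0], so [u] would be unbounded. *)
Lemma discounted_not_le_N1 lam u : 0 < lam -> eta lam <= e0 / 2 ->
  discounted_solution lam u -> ~ forall x, u x <= -1.
Proof.
move=> lam0 etal [cu Hu] uN1.
have [M M0 HM] := compact_bounded_fun X_compact cu.
have [M' M'0 HM'] := compact_bounded_fun X_compact u0_cont.
have [y [_ Hy]] := @calibrated u (fun z x => l z x (lam * u z) (lam * u x)) point Hu.
(* The first entry makes the chain cheap enough for [chain_e0]; the second makes the accumulated
   drift exceed the oscillations of [u] and [u0]. *)
have d0 : 0 < Num.min e0 (lam * (e0 / 2)) by rewrite lt_min e0_gt0 mulr_gt0 ?divr_gt0.
have [n [nA nB]] := exists_large_nat e0^-1 (2 * M + 2 * M') d0.
have nB1 : 2 * M + 2 * M' < e0 * n%:R.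
  by apply: lt_le_trans nB _; rewrite ler_wpM2r// ge_min lexx.
have nB2 : 2 * M + 2 * M' < lam * (e0 / 2) * n%:R.
  by apply: lt_le_trans nB _; rewrite ler_wpM2r// ge_min lexx orbT.
have Mu x : - M <= u x <= M by rewrite -ler_norml.
have Mu0 x : - M' <= u0 x <= M' by rewrite -ler_norml.
have lamu x : lam * u x <= - lam.
  by rewrite -[leRHS]mulrN1 ler_pM2l.
have tel := telescope_sum_ord (fun i => u (y i)) n.
have tel0 := telescope_sum_ord (fun i => u0 (y i)) n.
pose S0 := \sum_(i < n) l (y i.+1) (y i) 0 0.
pose SD := \sum_(i < n) cost_derivative l (y i.+1) (y i).
have S0_le : S0 <= u (y 0%N) - u (y n).
  rewrite -tel; apply: ler_sum => i _.
  have : l (y i.+1) (y i) 0 0 <=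
      l (y i.+1) (y i) (lam * u (y i.+1)) (lam * u (y i)).
    by apply: dec_uv; apply: le_trans (lamu _) _; rewrite oppr_le0 ltW.
  by have := Hy i; lra.
have S0_ge : u0 (y 0%N) - u0 (y n) <= S0.
  rewrite -tel0; apply: ler_sum => i _; rewrite lerBlDl.
  by have [_ +] := u0_kam (y i); apply; exists (y i.+1).
have := Mu (y 0%N); have := Mu (y n).
have := Mu0 (y 0%N); have := Mu0 (y n).
have SDle : SD <= - e0 * n%:R.
  apply: chain_e0 => //; rewrite -/S0.
  by have := Mu (y 0%N); have := Mu (y n); lra.
have main : S0 - lam * SD - lam * (e0 / 2) * n%:R <= u (y 0%N) - u (y n).
  rewrite -tel.
  have -> : S0 - lam * SD - lam * (e0 / 2) * n%:R =
      \sum_(i < n) (l (y i.+1) (y i) 0 0 -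
        lam * cost_derivative l (y i.+1) (y i) - lam * (e0 / 2)).
    by rewrite !sumrB -mulr_sumr sum_ord_cst.
  apply: ler_sum => i _.
  have : l (y i.+1) (y i) (- lam) (- lam) <=
      l (y i.+1) (y i) (lam * u (y i.+1)) (lam * u (y i)).
    by apply: dec_uv; exact: lamu.
  have := diagonal_expansion l_exp (y i.+1) (y i) (- lam).
  rewrite normrN (gtr0_norm lam0) ler_norml => /andP[+ _].
  have : lam * eta lam <= lam * (e0 / 2) by rewrite ler_pM2l.
  by have := Hy i; lra.
have : lam * SD <= lam * (- e0 * n%:R) by rewrite ler_pM2l.
have E : lam * (- e0 * n%:R) = - (lam * (e0 / 2) * n%:R) - lam * (e0 / 2) * n%:R.
  by field.
by rewrite E; lra.
Qed.

(** Mirror image along the chain of [u0]: there the costs at [(0, 0)] telescope exactly, and the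
    equation of [u] provides inequalities. *)
Lemma discounted_not_ge_1 lam u : 0 < lam -> eta lam <= e0 / 2 ->
  discounted_solution lam u -> ~ forall x, 1 <= u x.
Proof.
move=> lam0 etal [cu Hu] u1.
have [M M0 HM] := compact_bounded_fun X_compact cu.
have [M' M'0 HM'] := compact_bounded_fun X_compact u0_cont.
have [y [_ Hy]] := @calibrated u0 (fun z x => l z x 0 0) point u0_kam.
have d0 : 0 < Num.min e0 (lam * (e0 / 2)) by rewrite lt_min e0_gt0 mulr_gt0 ?divr_gt0.
have [n [nA nB]] := exists_large_nat e0^-1 (2 * M + 2 * M') d0.
have nB1 : 2 * M + 2 * M' < e0 * n%:R.
  by apply: lt_le_trans nB _; rewrite ler_wpM2r// ge_min lexx.
have nB2 : 2 * M + 2 * M' < lam * (e0 / 2) * n%:R.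
  by apply: lt_le_trans nB _; rewrite ler_wpM2r// ge_min lexx orbT.
have Mu x : - M <= u x <= M by rewrite -ler_norml.
have Mu0 x : - M' <= u0 x <= M' by rewrite -ler_norml.
have lamu x : lam <= lam * u x.
  by rewrite -[leLHS]mulr1 ler_pM2l.
have tel := telescope_sum_ord (fun i => u (y i)) n.
have tel0 := telescope_sum_ord (fun i => u0 (y i)) n.
pose S0 := \sum_(i < n) l (y i.+1) (y i) 0 0.
pose SD := \sum_(i < n) cost_derivative l (y i.+1) (y i).
have S0E : S0 = u0 (y 0%N) - u0 (y n).
  by rewrite -tel0; apply: eq_bigr => i _; rewrite [u0 (y i)]Hy; ring.
have := Mu (y 0%N); have := Mu (y n).
have := Mu0 (y 0%N); have := Mu0 (y n).
have SDle : SD <= - e0 * n%:R.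
  apply: chain_e0 => //; rewrite -/S0 S0E.
  by have := Mu0 (y 0%N); have := Mu0 (y n); lra.
have main : u (y 0%N) - u (y n) <= S0 + lam * SD + lam * (e0 / 2) * n%:R.
  rewrite -tel.
  have -> : S0 + lam * SD + lam * (e0 / 2) * n%:R =
      \sum_(i < n) (l (y i.+1) (y i) 0 0 +
        lam * cost_derivative l (y i.+1) (y i) + lam * (e0 / 2)).
    by rewrite !big_split/= -mulr_sumr sum_ord_cst.
  apply: ler_sum => i _.
  have : l (y i.+1) (y i) (lam * u (y i.+1)) (lam * u (y i)) <=
      l (y i.+1) (y i) lam lam by apply: dec_uv; exact: lamu.
  have := diagonal_expansion l_exp (y i.+1) (y i) lam.
  rewrite (gtr0_norm lam0) ler_norml => /andP[_].
  have : lam * eta lam <= lam * (e0 / 2) by rewrite ler_pM2l.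
  have [_ /(_ (u (y i.+1) + l (y i.+1) (y i) (lam * u (y i.+1)) (lam * u (y i))))] := Hu (y i).
  by move=> /(_ (ex_intro2 _ _ (y i.+1) I erefl)); lra.
have : lam * SD <= lam * (- e0 * n%:R) by rewrite ler_pM2l.
have E : lam * (- e0 * n%:R) = - (lam * (e0 / 2) * n%:R) - lam * (e0 / 2) * n%:R.
  by field.
by rewrite E; lra.
Qed.

(** The two preceding lemmas give values of [u] above -1 and below 1. One step of the equation
    bounds [u z' - u z] by [B + N / 2], with [- N] a lower bound of [u]; the factor 1/2 lets [N] be
    absorbed. *)
Lemma discounted_bounded : exists2 C, 0 < C & forall lam u, 0 < lam ->
  eta lam <= e0 / 2 -> lam * (ku + kv) <= 1 / 2 ->
  discounted_solution lam u -> forall x, `|u x| <= C.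
Proof.
have XX : compact [set: X * X] by rewrite -setXTT; exact: compact_setX.
have cl0 : continuous (fun p : X * X => l p.1 p.2 0 0).
  move=> p; apply: (cvg_uncurry4 l_cont); [exact: cvg_fst|exact: cvg_snd| |];
    exact: cvg_cst.
have [B B0 HB] := compact_bounded_fun XX cl0.
exists (2 * (1 + B)) => [|lam u lam0 etal lamk Hsol x]; first by lra.
have [cu Hu] := Hsol.
have [||xm _ Hxm] := @compact_EVT_min _ _ u [set: X] _ X_compact.
  by exists point.
  exact: continuous_subspaceT.
have {}Hxm z : u xm <= u z by apply: Hxm; rewrite inE.
pose N := - Num.min (u xm) 0.
have N0 : 0 <= N by rewrite oppr_ge0 ge_min lexx orbT.
have Nu z : - N <= u z by rewrite opprK ge_min Hxm.
have [x1 Hx1] : exists x1, -1 < u x1.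
  apply: contrapT => H; apply: (discounted_not_le_N1 lam0 etal Hsol) => z.
  by rewrite leNgt; apply/negP => zz; apply: H; exists z.
have [x2 Hx2] : exists x2, u x2 < 1.
  apply: contrapT => H; apply: (discounted_not_ge_1 lam0 etal Hsol) => z.
  by rewrite leNgt; apply/negP => zz; apply: H; exists z.
have sub z z' : u z' <= u z + B + N / 2.
  have [_ /(_ _ (ex_intro2 _ _ z I erefl))/=] := Hu z'.
  have NN : `|- (lam * N)| <= lam * N by rewrite normrN ger0_norm// mulr_ge0// ltW.
  have H1 : l z z' (lam * u z) (lam * u z') <= l z z' (- (lam * N)) (- (lam * N)).
    by apply: dec_uv; rewrite -mulrN ler_pM2l.
  have := lip_uv z z' NN NN; rewrite ler_norml => /andP[_].
  have := HB (z, z'); rewrite /= ler_norml => /andP[_].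
  have : (ku + kv) * (lam * N) <= 1 / 2 * N.
    by rewrite mulrA [(_ + _) * lam]mulrC ler_wpM2r.
  by move: H1; lra.
have N2 : N <= 2 * (1 + B).
  have := sub xm x1; rewrite /N; have [H|H] := leP (u xm) 0; last by lra.
  by move: Hx1; lra.
rewrite ler_norml; have := Nu x; have := sub x2 x.
by move=> *; apply/andP; split; lra.
Qed.

Lemma discounted_le : secants_le l -> exists2 lam1, 0 < lam1 &
  forall lam u w, 0 < lam -> lam <= lam1 ->
  discounted_solution lam u -> discounted_solution lam w -> forall x, w x <= u x.
Proof.
move=> sec; have [C C0 HC] := discounted_bounded.
have e04 : 0 < e0 / 4 by rewrite divr_gt0.
have [r r0 Hr] := sec _ e04.
have e02 : 0 < e0 / 2 by rewrite divr_gt0.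
have [s s0 Hs] := modulus_small eta_mod e02.
have k0 : 0 <= ku + kv by rewrite addr_ge0.
pose k1 := ku + kv + 1; have k10 : 0 < k1 by rewrite ltr_wpDl.
(* In order, the bounds give [eta lam <= e0 / 2], arguments within the radius [r],
   [lam * (ku + kv) <= 1 / 2], and a change of [l] by at most [e0 / 2] between [(0, 0)] and the
   arguments along the chain. *)
pose lam1 := Num.min (Num.min s (r / C)) (Num.min (1 / 2 / k1) (e0 / 2 / (k1 * C))).
have kC : 0 < k1 * C by rewrite mulr_gt0.
exists lam1 => [|lam u w lam0].
  by rewrite !lt_min s0 !divr_gt0.
rewrite !le_min => /andP[/andP[lams lamr] /andP[lamk lamkC]] Hu Hw x.
have etal : eta lam <= e0 / 2.
  by have /andP[] : 0 <= eta lam <= e0 / 2 by apply: Hs; rewrite ltW.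
have lamk' : lam * (ku + kv) <= 1 / 2.
  move: lamk; rewrite ler_pdivlMr// => /(le_trans _); apply.
  by rewrite ler_pM2l// lerDl.
have uC := HC lam u lam0 etal lamk' Hu.
have wC := HC lam w lam0 etal lamk' Hw.
have lamC : lam * C <= r by move: lamr; rewrite ler_pdivlMr.
have bC (f : X -> R) z : `|f z| <= C -> `|lam * f z| <= lam * C.
  by move=> fC; rewrite normrM gtr0_norm// ler_pM2l.
have br (f : X -> R) z : `|f z| <= C -> `|lam * f z| <= r.
  by move=> /bC/le_trans; apply.
have kC2 : (ku + kv) * (lam * C) <= e0 / 2.
  move: lamkC; rewrite ler_pdivlMr// => /(le_trans _); apply.
  by rewrite mulrCA ler_pM2l// ler_pM2r// lerDl.
rewrite leNgt; apply/negP => uwx.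
have [y [y0 Hy]] := @calibrated u (fun z x => l z x (lam * u z) (lam * u x)) x Hu.2.
pose D i := w (y i) - u (y i).
(* By (l2) the secants are nonpositive, so truncation at 0 preserves the bounds. The signs of [a i]
   and [b i] make [D] nondecreasing, so that [D i] can replace [D i.+1] in the term of [a i]. *)
pose a i := Num.min (partial_u l (y i.+1) (y i) 0 0 + e0 / 4) 0.
pose b i := Num.min (partial_v l (y i.+1) (y i) 0 0 + e0 / 4) 0.
have a0 i : a i <= 0 by rewrite ge_min lexx orbT.
have b0 i : b i <= 0 by rewrite ge_min lexx orbT.
have subw i : w (y i) <= w (y i.+1) + l (y i.+1) (y i) (lam * w (y i.+1)) (lam * w (y i)).
  by have [_ /(_ (y i))[_ ]] := Hw; apply; exists (y i.+1).
have Dstep i : 0 < D i -> D i - lam * (a i + b i) * D i <= D i.+1.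
  move=> Di.
  have lamD : lam * u (y i) <= lam * w (y i) by rewrite ler_pM2l// -subr_ge0 ltW.
  (* Were [D i.+1 <= 0], (l2) in the last argument and [lam * ku <= 1] in the other would give
     [w (y i) <= u (y i)]. *)
  have Di1 : 0 < D i.+1.
    rewrite ltNge; apply/negP => Di1.
    suff : D i <= 0 by rewrite leNgt Di.
    have wu : w (y i.+1) <= u (y i.+1) by rewrite -subr_le0.
    have lamwu : lam * w (y i.+1) <= lam * u (y i.+1) by rewrite ler_pM2l.
    have H1 : l (y i.+1) (y i) (lam * w (y i.+1)) (lam * w (y i)) <=
        l (y i.+1) (y i) (lam * w (y i.+1)) (lam * u (y i)) by exact: dec_uv.
    have [/(_ (y i.+1) (y i) (lam * u (y i)) (lam * w (y i.+1), lam * u (y i.+1)) (conj I I)) + _] := l_lip.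
    rewrite /= ler_norml => /andP[_].
    rewrite distrC ger0_norm ?subr_ge0// -mulrBr => H2.
    have H3 : ku * (lam * (u (y i.+1) - w (y i.+1))) <= u (y i.+1) - w (y i.+1).
      rewrite mulrA ler_piMl ?subr_ge0// mulrC.
      have : lam * ku <= lam * (ku + kv) by rewrite ler_pM2l// lerDl.
      by move: lamk'; lra.
    by have := Hy i; have := subw i; rewrite /D; lra.
  have lamD1 : lam * u (y i.+1) <= lam * w (y i.+1).
    by rewrite ler_pM2l// -subr_ge0 ltW.
  have [Hu1 _] := Hr (y i.+1) (y i) _ _ _ (br u _ (uC (y i.+1)))
    (br w _ (wC (y i.+1))) (br w _ (wC (y i))) lamD1.
  have [_ Hv1] := Hr (y i.+1) (y i) _ _ _ (br u _ (uC (y i)))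
    (br w _ (wC (y i))) (br u _ (uC (y i.+1))) lamD.
  have Ha : l (y i.+1) (y i) (lam * w (y i.+1)) (lam * w (y i)) -
      l (y i.+1) (y i) (lam * u (y i.+1)) (lam * w (y i)) <= a i * (lam * D i.+1).
    rewrite /a; have [H|H] := leP (partial_u l (y i.+1) (y i) 0 0 + e0 / 4) 0.
      by move: Hu1; rewrite -mulrBr.
    by rewrite mul0r subr_le0; exact: dec_uv.
  have Hb : l (y i.+1) (y i) (lam * u (y i.+1)) (lam * w (y i)) -
      l (y i.+1) (y i) (lam * u (y i.+1)) (lam * u (y i)) <= b i * (lam * D i).
    rewrite /b; have [H|H] := leP (partial_v l (y i.+1) (y i) 0 0 + e0 / 4) 0.
      by move: Hv1; rewrite -mulrBr.
    by rewrite mul0r subr_le0; exact: dec_uv.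
  have H1 : D i <= D i.+1 + a i * (lam * D i.+1) + b i * (lam * D i).
    by have := Hy i; have := subw i; move: Ha Hb; rewrite /D; lra.
  have aD : a i * (lam * D i.+1) <= 0.
    by rewrite mulr_le0_ge0// mulr_ge0// ltW.
  have bD : b i * (lam * D i) <= 0.
    by rewrite mulr_le0_ge0// mulr_ge0// ltW.
  have DD : D i <= D i.+1 by lra.
  have : a i * (lam * D i.+1) <= a i * (lam * D i).
    by rewrite ler_wnM2l// ler_pM2l.
  have -> : lam * (a i + b i) * D i = a i * (lam * D i) + b i * (lam * D i) by ring.
  lra.
have D0 : 0 < D 0%N by rewrite /D y0 subr_gt0.
(* The second conjunct keeps [D n] positive and bounds each increment below by its value at [D 0]:
   linear growth suffices. *)
have Dn n : D 0%N - lam * (\sum_(i < n) (a i + b i)) * D 0%N <= D n /\ D 0%N <= D n.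
  elim: n => [|n [IH1 IH2]]; first by rewrite big_ord0 mulr0 mul0r subr0.
  have Dn0 : 0 < D n by exact: lt_le_trans IH2.
  have := Dstep n Dn0.
  have ab0 : lam * (a n + b n) <= 0.
    by rewrite pmulr_rle0//; have := a0 n; have := b0 n; lra.
  have abD : lam * (a n + b n) * D n <= lam * (a n + b n) * D 0%N.
    by rewrite ler_wnM2l.
  have abD0 : lam * (a n + b n) * D 0%N <= 0 by rewrite mulr_le0_ge0// ltW.
  rewrite big_ord_recr/=; move: IH1; set S := \sum_(i < n) _ => IH1 Hstep.
  have -> : lam * (S + (a n + b n)) * D 0%N =
    lam * S * D 0%N + lam * (a n + b n) * D 0%N by ring.
  by split; lra.
(* The first entry serves the hypothesis of [chain_e0], half of whose slack is spent on replacing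
   the arguments of [l] by 0; the second makes the growth of [D] exceed its bound [2 * C]. *)
have d0 : 0 < Num.min (e0 / 2) (lam * (e0 / 2) * D 0%N).
  by rewrite lt_min e02 !mulr_gt0.
have [n [nA nB]] := exists_large_nat e0^-1 (2 * C) d0.
have nB1 : 2 * C < e0 / 2 * n%:R.
  by apply: lt_le_trans nB _; rewrite ler_wpM2r// ge_min lexx.
have nB2 : 2 * C < lam * (e0 / 2) * D 0%N * n%:R.
  by apply: lt_le_trans nB _; rewrite ler_wpM2r// ge_min lexx orbT.
have uCC z : - C <= u z <= C by rewrite -ler_norml.
have wCC z : - C <= w z <= C by rewrite -ler_norml.
have tel := telescope_sum_ord (fun i => u (y i)) n.
have S0 : \sum_(i < n) l (y i.+1) (y i) 0 0 <= e0 * n%:R.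
  have : \sum_(i < n) (l (y i.+1) (y i) 0 0 - e0 / 2) <= u (y 0%N) - u (y n).
    rewrite -tel; apply: ler_sum => i _.
    have := lip_uv (y i.+1) (y i) (bC u _ (uC (y i.+1))) (bC u _ (uC (y i))).
    by rewrite ler_norml => /andP[+ _]; have := Hy i; move: kC2; lra.
  rewrite sumrB sum_ord_cst.
  by have := uCC (y 0%N); have := uCC (y n); move: nB1; lra.
have SD := chain_e0 nA S0.
have Sab : \sum_(i < n) (a i + b i) <= - (e0 / 2) * n%:R.
  have : \sum_(i < n) (a i + b i) <=
      \sum_(i < n) (cost_derivative l (y i.+1) (y i) + e0 / 2).
    apply: ler_sum => i _.
    have : a i <= partial_u l (y i.+1) (y i) 0 0 + e0 / 4 by rewrite ge_min lexx.
    have : b i <= partial_v l (y i.+1) (y i) 0 0 + e0 / 4 by rewrite ge_min lexx.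
    by rewrite /cost_derivative; lra.
  by rewrite [leRHS]big_split/= sum_ord_cst; move: SD; lra.
have [Dn1 _] := Dn n.
have : lam * (\sum_(i < n) (a i + b i)) * D 0%N <= lam * (- (e0 / 2) * n%:R) * D 0%N.
  by rewrite ler_pM2r// ler_pM2l.
have -> : lam * (- (e0 / 2) * n%:R) * D 0%N = - (lam * (e0 / 2) * D 0%N * n%:R) by ring.
have : D n <= 2 * C by rewrite /D; have := uCC (y n); have := wCC (y n); lra.
by move: Dn1 nB2 D0; lra.
Qed.

End FixedPoints.

(** * Existence and uniqueness of the fixed point for small parameters *)

Unset Implicit Arguments.

Theorem theorem6 (R : realType) (X : pmetricType R)
  (X_compact : compact [set: X])
  (l : X -> X -> R -> R -> R) (l_cont : continuous (uncurry4 l))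
  (kappa_u kappa_v : R) (kappa_u_ge0 : 0 <= kappa_u) (kappa_v_ge0 : 0 <= kappa_v)
  (l1 : cost_lipschitz l kappa_u kappa_v)
  (l2 : cost_nonincreasing l)
  (eta : R -> R) (eta_modulus : modulus_of_continuity eta)
  (l3 : cost_expansion l eta)
  (critical0 : is_critical_constant (fun z x => l z x 0 0) 0)
  (l4 : mather_negative l 0)
  (lambda0 : R) (lambda0_gt0 : 0 < lambda0)
  (lambda0_small : lambda0 * Num.max kappa_u kappa_v < 1)
  (l_regular : cost_concave l \/ cost_C1_near0 l) :
  exists lambda1 : R, 0 < lambda1 < lambda0 /\
    forall lambda : R, 0 < lambda < lambda1 ->
      exists! u : X -> R, continuous u /\ lax_oleinik l lambda u = u.
Proof.
have [[u0 [cu0 Hu0]] _] := critical0.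
have {}Hu0 x : is_min (range (fun z => u0 z + l z x 0 0)) (u0 x).
  by have := Hu0 x; rewrite subr0.
have u0_sub z x : u0 x <= u0 z + l z x 0 0.
  by have [_] := Hu0 x; apply; exists z.
have cl0 : continuous (fun p : X * X => l p.1 p.2 0 0).
  move=> p; apply: (cvg_uncurry4 l_cont); [exact: cvg_fst|exact: cvg_snd| |];
    exact: cvg_cst.
have cD := cost_derivative_continuous l_cont eta_modulus l3.
have [e0 e0_gt0 chain_e0] := chain_averages X_compact cl0 cD cu0 u0_sub l4.
have sec : secants_le l.
  case: l_regular => Hl; first exact: concave_secants_le eta_modulus l3 Hl.
  exact: (C1_secants_le X_compact Hl).
have [lam1 lam1_gt0 Hle] := discounted_le X_compact l_cont kappa_u_ge0
  kappa_v_ge0 l1 l2 eta_modulus l3 cu0 Hu0 e0_gt0 chain_e0 sec.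
(* Halving [lambda0] makes the inequality [lambda1 < lambda0] strict. *)
exists (Num.min lam1 (lambda0 / 2)); split.
  rewrite lt_min lam1_gt0 divr_gt0//= gt_min; apply/orP; right.
  by rewrite ltr_pdivrMr//; lra.
move=> lam /andP[lam_gt0]; rewrite lt_min => /andP[lam_lam1 lam_lambda0].
have lam_ku : lam * kappa_u <= 1.
  apply/ltW/(le_lt_trans _ lambda0_small); apply: ler_pM => //.
  - exact: ltW.
  - by lra.
  - by rewrite le_max lexx.
have fixedP u (cu : continuous u) := lax_oleinik_fixedP X_compact l_cont
  kappa_v_ge0 l1 l2 lam_gt0 lam_ku cu.
have [u [cu uE]] := exists_fixed_point X_compact l_cont kappa_v_ge0
  l1 l2 lam_gt0 lam_ku cu0 Hu0.
exists u; split=> // w [cw wE].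
have Su : discounted_solution l lam u by split=> //; exact: (fixedP u cu).1.
have Sw : discounted_solution l lam w by split=> //; exact: (fixedP w cw).1.
have le1 := Hle lam _ _ lam_gt0 (ltW lam_lam1).
by apply/funext => x; apply/eqP; rewrite eq_le !le1.
Qed.
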